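(* Let $\mathcal{M}$ be a weakly closed $^*$-subalgebra of $B(H)$, let $h\in H$, and let $0<T\in\mathcal{L}^{1,\infty}$ be $(\mathcal{M},h)$-dominated. Then for all $\omega\in\mathcal{L}(BL\cap DL)$ the functional $A\mapsto\mathrm{Tr}_\omega(AT)$ on $\mathcal{M}$ belongs to the predual $\mathcal{M}_*$ (i.e. it is a normal functional on $\mathcal{M}$).
   Context: $H$ is a separable complex Hilbert space, $B(H)$ the bounded linear operators on $H$. A positive compact operator $T$ is $(\mathcal{M},h)$-dominated, $h\in H$, if for some complete orthonormal system $\{h_m\}_{m=1}^\infty$ of eigenvectors of $T$ one has $\|Ph_m\|\le\|Ph\|$ for all $m$ and all projections $P\in\mathcal{M}$. For a compact operator $T$, $\mu_1(T)\ge\mu_2(T)\ge\dots$ are its singular values (with multiplicity). $\mathcal{L}^{1,\infty}$ is the set of compact $T$ with $\sup_n \log(1+n)^{-1}\sum_{j=1}^n\mu_j(T)<\infty$. $0<T$ means $T$ is a positive operator. On $\ell^\infty$ define, for $j\in\mathbb{N}$, $T_j(\{a_k\}_{k=1}^\infty) = \{a_{k+j}\}_{k=1}^\infty$ and $D_j(\{a_k\}_{k=1}^\infty) = \{a_{\lceil k/j\rceil}\}_{k=1}^\infty$. $BL$ (resp. $DL$) is the set of states $\omega$ on $\ell^\infty$ (positive functionals with $\omega(1)=1$) with $\omega\circ T_j=\omega$ (resp. $\omega\circ D_j=\omega$) for all $j\in\mathbb{N}$. For $0<T\in\mathcal{L}^{1,\infty}$ let $\gamma(T) := \{\log(1+k)^{-1}\sum_{j=1}^k\mu_j(T)\}_{k=1}^\infty\in\ell^\infty$.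 $DL_2$ is the set of states $\omega$ on $\ell^\infty$ such that $\liminf_k a_k\le\omega(\{a_k\})\le\limsup_k a_k$ for all $\{a_k\}\ge 0$ in $\ell^\infty$ and $\omega(D_2(\gamma(T)))=\omega(\gamma(T))$ for all $0<T\in\mathcal{L}^{1,\infty}$. For $\omega\in DL_2$, $\mathrm{Tr}_\omega(T):=\omega(\gamma(T))$, $0<T\in\mathcal{L}^{1,\infty}$, defines a tracial weight, and $\mathrm{Tr}_\omega$ also denotes its linear extension to $\mathcal{L}^{1,\infty}$. Define $E:L^\infty([0,\infty))\to\ell^\infty$ by $E_k(f)=\int_{k-1}^k f(t)\,dt$; $L^{-1}:L^\infty([1,\infty))\to L^\infty([0,\infty))$ by $L^{-1}(g)(t)=g(e^t)$; $p:\ell^\infty\to L^\infty([1,\infty))$ by $p(\{a_k\})(t)=\sum_{k=1}^\infty a_k\chi_{[k,k+1)}(t)$; and $\mathcal{L}:(\ell^\infty)^*\to(\ell^\infty)^*$ by $\mathcal{L}(\xi):=\xi\circ E\circ L^{-1}\circ p$. $\mathcal{L}(BL\cap DL)$ is the image of $BL\cap DL$ under $\mathcal{L}$; it is contained in $DL_2$. *)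

(* Defs.v *)
From mathcomp Require Import all_boot all_order all_algebra.
From mathcomp Require Import all_classical all_reals all_analysis.
From mathcomp Require Import complex.

Set Implicit Arguments.
Unset Strict Implicit.
Unset Printing Implicit Defensive.

Import Order.TTheory GRing.Theory Num.Theory numFieldNormedType.Exports.

Local Open Scope classical_set_scope.
Local Open Scope ring_scope.
Local Open Scope complex_scope.

(* A sequence {a_k}_{k >= 1} is the function on nat sending k to a_{k + 1}.
   Scalars are real: states of the complex l^infty are the complexifications of
   states of the real one, and every map below commutes with complexification. *)
Section sequences.
Context {R : realType}.
Implicit Types (a : nat -> R) (w xi : (nat -> R) -> R).

Definition linfty : set (nat -> R) :=
  [set a | exists K, forall k, `|a k| <= K].

(* A functional on l^infty is a total function of which only the values on
   bounded sequences matter. *)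
Definition state w : Prop :=
  [/\ forall c a b, linfty a -> linfty b ->
        w (fun k => c * a k + b k) = c * w a + w b,
      forall a, linfty a -> (forall k, 0 <= a k) -> 0 <= w a
    & w (fun=> 1) = 1].

Definition translate (j : nat) a : nat -> R := fun k => a (k + j)%N.

(* a_{ceil(k / j)}, k >= 1: with k = i + 1 one has ceil(k / j) - 1 = i %/ j. *)
Definition dilate (j : nat) a : nat -> R := fun i => a (i %/ j)%N.

Definition BL : set ((nat -> R) -> R) :=
  [set w | state w /\
    forall j a, (0 < j)%N -> linfty a -> w (translate j a) = w a].

Definition DL : set ((nat -> R) -> R) :=
  [set w | state w /\
    forall j a, (0 < j)%N -> linfty a -> w (dilate j a) = w a].

Definition Emap (f : R -> R) : nat -> R :=
  fun k => \int[lebesgue_measure]_(t in `[k%:R, k.+1%:R]) f t.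

Definition Linv (g : R -> R) : R -> R := fun t => g (expR t).

Definition step_fun (a : nat -> R) : R -> R :=
  fun t => limn (series (fun k => a k * \1_`[k.+1%:R, k.+2%:R[ t)).

Definition Lmap xi : (nat -> R) -> R := fun a => xi (Emap (Linv (step_fun a))).

End sequences.

(* A complex Hilbert space is a complete normed module H over R[i] with a
   positive definite Hermitian form ip, linear in its first argument, that
   induces the norm. *)
Section operators.
Context {R : realType} {H : completeNormedModType R[i]}.
Variable ip : {dot H for Num.conj}.
Implicit Types (A B P S T : H -> H) (M : set (H -> H)) (h v x y : H).

Definition hilbert_norm : Prop := forall x, ip x x = `|x| ^+ 2.

Definition separable : Prop := exists2 D : set H, countable D & dense D.

Definition bounded_op : set (H -> H) := [set A | linear A /\ continuous A].

Definition is_adjoint A B : Prop := forall x y, ip (A x) y = ip x (B y).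

Definition projection P : Prop :=
  [/\ bounded_op P, is_adjoint P P & P \o P = P].

(* The order on R[i] makes [0 <= z] say that z is real and nonnegative. *)
Definition positive_op T : Prop := bounded_op T /\ forall x, 0 <= ip (T x) x.

Definition compact_op T : Prop :=
  bounded_op T /\ precompact (T @` [set x | `|x| <= 1]).

Definition star_subalgebra M : Prop :=
  [/\ M `<=` bounded_op, M 0,
      forall (c : R[i]) A B, M A -> M B -> M (c *: A + B),
      forall A B, M A -> M B -> M (A \o B)
    & forall A, M A -> exists2 B, M B & is_adjoint A B].

(* Evaluation of all functionals A |-> <A x, y>; the weak operator topology is
   the initial topology of this map. *)
Definition wot_map A : {ptws (H * H) -> R[i]^o} :=
  fun xy => ip (A xy.1) xy.2.

Definition weakly_closed M : Prop :=
  bounded_op `&` closure (M : set (initial_topology wot_map)) `<=` M.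

Definition ell2 : set (nat -> H) :=
  [set x | cvgn (series (fun n => `|x n| ^+ 2 : R[i]^o))].

(* Evaluation of all functionals A |-> sum_n <A x_n, y_n> with
   sum_n |x_n|^2, sum_n |y_n|^2 < oo; the ultraweak topology is the initial
   topology of this map. *)
Definition ultraweak_map A : {ptws (ell2 * ell2) -> R[i]^o} :=
  fun xy => limn (series
    (fun n => ip (A (set_val xy.1 n)) (set_val xy.2 n) : R[i]^o)).

(* M_*: the ultraweakly continuous linear functionals on M *)
Definition predual M : set ((H -> H) -> R[i]) :=
  [set phi |
    (forall (c : R[i]) A B, M A -> M B ->
       phi (c *: A + B) = c * phi A + phi B) /\
    {within (M : set (initial_topology ultraweak_map)),
       continuous (phi : initial_topology ultraweak_map -> R[i]^o)}].

(* The first n vectors of e are orthonormal. *)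
Definition orthonormal_upto (n : nat) (e : nat -> H) : Prop :=
  forall i j, (i < n)%N -> (j < n)%N -> ip (e i) (e j) = (i == j)%:R.

Definition complete_orthonormal (e : nat -> H) : Prop :=
  (forall i j, ip (e i) (e j) = (i == j)%:R) /\
  (forall x, (forall i, ip x (e i) = 0) -> x = 0).

Definition dominated M h T : Prop :=
  [/\ positive_op T, compact_op T
    & exists e : nat -> H,
      [/\ complete_orthonormal e,
          forall m, exists c : R[i], T (e m) = c *: e m
        & forall P, M P -> projection P -> forall m, `|P (e m)| <= `|P h|]].

(* v satisfies |T| v = l v, where |T| = (T* T)^(1/2). *)
Definition abs_eigenvector T (l : R) v : Prop :=
  0 <= l /\ exists2 S, is_adjoint T S & S (T v) = (l ^+ 2)%:C *: v.

(* [mu T n] is mu_(n+1)(T), the (n+1)-st largest eigenvalue of |T| counted with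
   multiplicity, T compact: the largest l such that the eigenspaces of |T| for
   eigenvalues at least l have total dimension at least n + 1.  It is 0 past
   the rank of T (also when H has dimension at most n, as sup set0 = 0). *)
Definition mu T (n : nat) : R :=
  sup [set l | exists2 e, orthonormal_upto n.+1 e &
         forall i, (i < n.+1)%N -> exists2 l', l <= l' &
           abs_eigenvector T l' (e i)].

Definition gamma T : nat -> R :=
  fun k => (ln (k.+2)%:R)^-1 * \sum_(j < k.+1) mu T j.

Definition L1infty T : Prop :=
  compact_op T /\ exists K, forall k, gamma T k <= K.

Definition positive_L1infty T : Prop := positive_op T /\ L1infty T.

(* The linear extension of T |-> w (gamma T), 0 <= T, to the span of the
   positive operators: S = T1 - T2 + i (T3 - T4) is sent to
   w (gamma T1) - w (gamma T2) + i (w (gamma T3) - w (gamma T4)).  For w in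
   Lmap @` (BL `&` DL) this does not depend on the decomposition of S. *)
Definition Tr (w : (nat -> R) -> R) S : R[i] :=
  xget 0 [set c | exists T1 T2 T3 T4,
    [/\ [/\ positive_L1infty T1, positive_L1infty T2,
            positive_L1infty T3 & positive_L1infty T4],
        S = T1 - T2 + ('i : R[i]) *: (T3 - T4)
      & c = (w (gamma T1) - w (gamma T2))
            +i* (w (gamma T3) - w (gamma T4))]].

End operators.

(* Main.v *)
From HB Require Import structures.
Require Import Defs.
From mathcomp Require Import all_boot all_order all_algebra.
From mathcomp Require Import all_classical all_reals all_analysis.
From mathcomp Require Import complex measurable_realfun.
From mathcomp Require Import ring lra zify.

(* Write [tau S = w (gamma S)] for positive [S] in L^{1,oo}.  Ky Fan's maximum
   principle gives [K_n(S + T) <= K_n S + K_n T <= K_{2n}(S + T)] for the partial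
   sums [K_n] of singular values; since [2 floor(e^t) <= floor(e^(t + 1))] and
   [w] comes from a translation invariant [xi] by averaging over [k, k + 1] in
   the variable [t = log n], [tau] is additive.

   Let [v] enumerate the given eigenvectors by decreasing eigenvalues [s_j] of
   [T], and let [psi A = w ((log n)^-1 sum_(j < n) s_j <A v_j, v_j>)].  By Ky Fan
   [tau (X T X^* ) - psi (X^* X)] is nonnegative; it is a quadratic form in [X]
   that vanishes at scalars, so it does not change when a scalar is added to [X].
   Polarizing [A T] into the operators [X T X^*], [X = (A + i^k) / 2], yields
   [Tr_w (A T) = psi A], and hence [|Tr_w (A T)| <= C sup_m |A e_m|].

   The hypothesis on projections extends to [|A e_m| <= |A h|] for [A] in [M]:
   by weak compactness some [B] maximizes [<B e_m, e_m> - <B h, h>] among the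
   [0 <= B <= 1] in [M]; as [B] is the mean of [B^2] and [2 B - B^2], [B^2] is
   again a maximizer, and so is the projection [lim B^(2^n)].  By the Riesz
   theorem on the subspace [M h], [Tr_w (A T) = <A h, k>] for some [k]. *)

Set Implicit Arguments.
Unset Strict Implicit.
Unset Printing Implicit Defensive.

Import Order.TTheory GRing.Theory Num.Theory numFieldNormedType.Exports.
Local Open Scope classical_set_scope.
Local Open Scope ring_scope.
Local Open Scope complex_scope.

(** The trace is given on positive operators and extended by decompositions, while [A T] is not
    positive. All operators fed to it are therefore of the form [X T X^*]: they are positive for
    every bounded [X], and Ky Fan bounds their partial sums from both sides through [T] alone, with
    no square root or polar decomposition. The scalars added to [X] are operators on [H] and need
    not lie in [M].

    [M] is not assumed to contain the identity of [H], and no spectral theorem is used. This is why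
    a maximizer is iterated instead of cutting [A] by spectral projections, and why only [B^2] and
    [2 B - B^2], polynomials without constant term, appear.

    The point of [|A e_m| <= |A h|] is that one vector controls all [m] at once: the whole diagonal
    [<A v_j, v_j>] is bounded by [|A h|], so the functional factors through [A |-> A h]. *)

Local Notation Re := complex.Re.
Local Notation Im := complex.Im.
Local Notation normc := Normc.normc.

(** * Complex numbers through their real and imaginary parts and the real modulus [normc] *)

Section complex_facts.
Context {R : realType}.
Implicit Types z w : R[i].

Lemma ReD z w : Re (z + w) = Re z + Re w.
Proof. by case: z => a b; case: w => c d; simpc. Qed.
Lemma ImD z w : Im (z + w) = Im z + Im w.
Proof. by case: z => a b; case: w => c d; simpc. Qed.
Lemma ReN z : Re (- z) = - Re z. Proof. by case: z => a b; simpc. Qed.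
Lemma ImN z : Im (- z) = - Im z. Proof. by case: z => a b; simpc. Qed.
Lemma ReM z w : Re (z * w) = Re z * Re w - Im z * Im w.
Proof. by case: z => a b; case: w => c d; simpc. Qed.
Lemma ImM z w : Im (z * w) = Re z * Im w + Im z * Re w.
Proof. by case: z => a b; case: w => c d; simpc. Qed.
Lemma ReJ z : Re (z^*)%C = Re z. Proof. by case: z. Qed.
Lemma ImJ z : Im (z^*)%C = - Im z. Proof. by case: z. Qed.
Lemma Re_sum I (r : seq I) (P : pred I) (F : I -> R[i]) :
  Re (\sum_(i <- r | P i) F i) = \sum_(i <- r | P i) Re (F i).
Proof. by apply: (big_morph (@Re R)) => [x y|]; rewrite ?ReD. Qed.
Lemma complex_ext z w : Re z = Re w -> Im z = Im w -> z = w.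
Proof. by case: z; case: w => ? ? ? ? /= -> ->. Qed.
Lemma normc_sqr z : normc z ^+ 2 = Re z ^+ 2 + Im z ^+ 2.
Proof.
by case: z => a b; rewrite /normc /= sqr_sqrtr// addr_ge0 ?sqr_ge0.
Qed.
Lemma normc_ge0 z : 0 <= normc z.
Proof. by case: z => a b; rewrite /normc /= sqrtr_ge0. Qed.
Lemma norm_normc z : `|z| = (normc z)%:C.
Proof. by case: z => a b; rewrite normc_def. Qed.

Lemma normc_real (r : R) : normc r%:C = `|r|.
Proof. by rewrite /Normc.normc /= expr0n addr0 sqrtr_sqr. Qed.
Lemma normcD z w : normc (z + w) <= normc z + normc w.
Proof. by rewrite -lecR rmorphD /= -!norm_normc ler_normD. Qed.
Lemma normcM z w : normc (z * w) = normc z * normc w.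
Proof. by apply: complexI; rewrite rmorphM /= -!norm_normc normrM. Qed.
Lemma normcN z : normc (- z) = normc z.
Proof. by apply: complexI; rewrite -!norm_normc normrN. Qed.
Lemma normcB z w : normc (z - w) = normc (w - z).
Proof. by rewrite -normcN opprB. Qed.
Lemma normc_eq0 z : normc z = 0 -> z = 0.
Proof. by move=> h; apply/eqP; rewrite -normr_eq0 norm_normc h. Qed.
Lemma normcJ z : normc (z^*)%C = normc z.
Proof. by case: z => r s; rewrite /Normc.normc /= sqrrN. Qed.
Lemma Re_le_normc z : `|Re z| <= normc z.
Proof.
rewrite -(@ler_pXn2r _ 2%N) ?nnegrE ?normc_ge0// real_normK ?num_real//.
by rewrite normc_sqr lerDl sqr_ge0.
Qed.
Lemma Im_le_normc z : `|Im z| <= normc z.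
Proof.
rewrite -(@ler_pXn2r _ 2%N) ?nnegrE ?normc_ge0// real_normK ?num_real//.
by rewrite normc_sqr lerDr sqr_ge0.
Qed.
Lemma normc_le_ReIm z : normc z <= `|Re z| + `|Im z|.
Proof.
have e : z = (Re z)%:C + (0 +i* Im z) by apply: complex_ext; rewrite !(ReD, ImD) /= ?addr0 ?add0r.
rewrite {1}e; apply: le_trans (normcD _ _) _.
by rewrite /Normc.normc /= !expr0n /= addr0 add0r !sqrtr_sqr.
Qed.

End complex_facts.

(** * Inner products and operators *)

Section hilbert.
Context {R : realType} {H : completeNormedModType R[i]}.
Variable ip : {dot H for Num.conj}.
Implicit Types (a b : R[i]) (x y z u v : H).

Lemma ipDl x y z : ip (x + y) z = ip x z + ip y z.
Proof. exact: linearDl. Qed.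
Lemma ipZl a x z : ip (a *: x) z = a * ip x z.
Proof. exact: linearZl_LR. Qed.
Lemma ipDr x y z : ip z (x + y) = ip z x + ip z y.
Proof. exact: linearDr. Qed.
Lemma ipZr a x z : ip z (a *: x) = (a^*)%C * ip z x.
Proof. exact: linearZr_LR. Qed.
Lemma ip0l z : ip 0 z = 0. Proof. exact: linear0l. Qed.
Lemma ip0r z : ip z 0 = 0. Proof. exact: linear0r. Qed.
Lemma ipNl x z : ip (- x) z = - ip x z. Proof. exact: linearNl. Qed.
Lemma ipNr x z : ip z (- x) = - ip z x. Proof. exact: linearNr. Qed.
Lemma ipBl x y z : ip (x - y) z = ip x z - ip y z.
Proof. exact: linearBl. Qed.
Lemma ipBr x y z : ip z (x - y) = ip z x - ip z y.
Proof. exact: linearBr. Qed.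
Lemma ip_suml I (r : seq I) (P : pred I) (F : I -> H) z :
  ip (\sum_(i <- r | P i) F i) z = \sum_(i <- r | P i) ip (F i) z.
Proof. by apply: (big_morph (ip^~ z)) => [x y|]; rewrite ?ipDl ?ip0l. Qed.
Lemma ip_sumr I (r : seq I) (P : pred I) (F : I -> H) z :
  ip z (\sum_(i <- r | P i) F i) = \sum_(i <- r | P i) ip z (F i).
Proof. by apply: (big_morph (ip z)) => [x y|]; rewrite ?ipDr ?ip0r. Qed.
Lemma ipC x y : ip x y = ((ip y x)^*)%C.
Proof. by rewrite hermC expr0 mul1r. Qed.

Definition re_ip x y : R := Re (ip x y).
Local Notation rip := re_ip.
Definition nrm x : R := Re `|x|.

Lemma ripC x y : rip x y = rip y x.
Proof. by rewrite /re_ip ipC ReJ. Qed.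
Lemma ripDl x y z : rip (x + y) z = rip x z + rip y z.
Proof. by rewrite /re_ip ipDl ReD. Qed.
Lemma ripDr x y z : rip z (x + y) = rip z x + rip z y.
Proof. by rewrite /re_ip ipDr ReD. Qed.
Lemma ripBl x y z : rip (x - y) z = rip x z - rip y z.
Proof. by rewrite /re_ip ipBl ReD ReN. Qed.
Lemma ripBr x y z : rip z (x - y) = rip z x - rip z y.
Proof. by rewrite /re_ip ipBr ReD ReN. Qed.
Lemma ripNl x z : rip (- x) z = - rip x z.
Proof. by rewrite /re_ip ipNl ReN. Qed.
Lemma ripNr x z : rip z (- x) = - rip z x.
Proof. by rewrite /re_ip ipNr ReN. Qed.
Lemma rip0l x : rip 0 x = 0. Proof. by rewrite /re_ip ip0l. Qed.
Lemma rip0r x : rip x 0 = 0. Proof. by rewrite /re_ip ip0r. Qed.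
Lemma ripZl (r : R) x z : rip (r%:C *: x) z = r * rip x z.
Proof. by rewrite /re_ip ipZl ReM /= mul0r subr0. Qed.
Lemma ripZr (r : R) x z : rip z (r%:C *: x) = r * rip z x.
Proof. by rewrite ripC ripZl ripC. Qed.
Lemma ipxxE x : ip x x = (rip x x)%:C.
Proof. by apply: complex_ext => //=; have := ipC x x; case: (ip x x) => a b [] /=; lra. Qed.

Hypothesis hn : hilbert_norm ip.

Lemma normE x : `|x| = (nrm x)%:C.
Proof.
have : 0 <= `|x| by [].
by rewrite /nrm; case: `|x| => a b; rewrite lecE /= => /andP[/eqP -> _].
Qed.
Lemma nrm_ge0 x : 0 <= nrm x.
Proof. by rewrite -ler0c -normE. Qed.
Lemma ripxx x : rip x x = nrm x ^+ 2.
Proof. by rewrite /re_ip hn normE -rmorphXn. Qed.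
Lemma nrm0 : nrm 0 = 0. Proof. by rewrite /nrm normr0. Qed.
Lemma nrm_eq0 x : nrm x = 0 -> x = 0.
Proof. by move=> h; apply/eqP; rewrite -normr_eq0 normE h. Qed.
Lemma nrmN x : nrm (- x) = nrm x. Proof. by rewrite /nrm normrN. Qed.
Lemma nrmD x y : nrm (x + y) <= nrm x + nrm y.
Proof. by have := ler_normD x y; rewrite !normE -rmorphD lecR. Qed.
Lemma nrmB x y : nrm (x - y) <= nrm x + nrm y.
Proof. by rewrite -(nrmN y) nrmD. Qed.
Lemma nrmZ a x : nrm (a *: x) = normc a * nrm x.
Proof.
apply: complexI.
by rewrite rmorphM/= -!normE normrZ norm_normc.
Qed.
Lemma ip_self x : ip x x = (nrm x ^+ 2)%:C.
Proof. by rewrite ipxxE ripxx. Qed.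
Lemma rip_self_eq0 x : rip x x = 0 -> x = 0.
Proof. by rewrite ripxx => /eqP; rewrite sqrf_eq0 => /eqP /nrm_eq0. Qed.
Lemma ip_sep x y : (forall z, ip x z = ip y z) -> x = y.
Proof.
move=> h; apply/eqP; rewrite -subr_eq0; apply/eqP/rip_self_eq0.
by rewrite /re_ip ipBl h subrr.
Qed.

(** The form may be degenerate: besides the inner product it is applied to [<S x, y>] with [S]
    positive, where [D y y = 0] does not force [y = 0]. Hence the separate null case. *)
Lemma psd_cauchy (D : H -> H -> R) :
  (forall x y, D x y = D y x) ->
  (forall x y z, D (x + y) z = D x z + D y z) ->
  (forall (r : R) x z, D (r%:C *: x) z = r * D x z) ->
  (forall x, 0 <= D x x) ->
  forall x y, D x y ^+ 2 <= D x x * D y y.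
Proof.
move=> dC dD dZ d0 x y.
have key (t s : R) : 0 <= t ^+ 2 * D x x + 2 * t * s * D x y + s ^+ 2 * D y y.
  have := d0 (t%:C *: x + s%:C *: y).
  rewrite dD !dZ (dC x (_ + _)) (dC y (_ + _)) !dD !dZ (dC y x).
  by congr (_ <= _); ring.
have [yy|yy] := eqVneq (D y y) 0.
  rewrite yy mulr0.
  have [->|xy] := eqVneq (D x y) 0; first by rewrite expr0n.
  (* For [D y y = 0] the expression is affine in [s]; this [s] brings it down to [- D x x - 2]. *)
  have := key 1 (- (D x x + 1) / D x y); rewrite yy => k.
  have {k}: 0 <= D x x - 2 * (D x x + 1).
    by move: k; congr (_ <= _); field.
  have := d0 x; lra.
have {}yy : 0 < D y y by rewrite lt_def yy d0.
rewrite -subr_ge0 -(pmulr_rge0 _ yy).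
(* At these values the quadratic is [D y y * (D x x * D y y - D x y ^+ 2)]. *)
by have := key (D y y) (- D x y); congr (_ <= _); ring.
Qed.

Lemma rip_cs2 x y : rip x y ^+ 2 <= nrm x ^+ 2 * nrm y ^+ 2.
Proof.
rewrite -!ripxx; apply: psd_cauchy => *; rewrite ?ripDl ?ripZl //; first exact: ripC.
by rewrite ripxx sqr_ge0.
Qed.
Lemma rip_cs x y : `|rip x y| <= nrm x * nrm y.
Proof.
rewrite -(@ler_pXn2r _ 2%N) ?nnegrE ?mulr_ge0 ?nrm_ge0//.
by rewrite real_normK ?num_real// exprMn rip_cs2.
Qed.
Lemma rip_le x y : rip x y <= nrm x * nrm y.
Proof. exact: le_trans (ler_norm _) (rip_cs x y). Qed.
Lemma normc_ip x y : normc (ip x y) <= nrm x * nrm y.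
Proof.
rewrite -(@ler_pXn2r _ 2%N) ?nnegrE ?mulr_ge0 ?nrm_ge0 ?normc_ge0//.
pose c := ip x y.
(* Multiplying [x] by the conjugate of [c = <x, y>] turns the inner product into the real number
   [|c|^2], so the bound on real parts suffices. *)
have : rip ((c^*)%C *: x) y <= nrm ((c^*)%C *: x) * nrm y by exact: rip_le.
rewrite /re_ip ipZl -/c nrmZ normcJ.
have -> : Re ((c^*)%C * c) = normc c ^+ 2.
  by rewrite normc_sqr; case: (c) => ? ? /=; ring.
have := normc_ge0 c; set n := normc c => n0.
have : 0 <= nrm x * nrm y by rewrite mulr_ge0 ?nrm_ge0.
rewrite -mulrA; set m := nrm x * nrm y => m0 h.
have [->|nn] := eqVneq n 0; first by rewrite expr0n sqr_ge0.
have : n <= m by move: h; rewrite expr2 ler_pM2l// lt_def nn.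
by move=> nm; rewrite ler_pXn2r ?nnegrE.
Qed.

End hilbert.

Section operators.
Context {R : realType} {H : completeNormedModType R[i]}.
Variable ip : {dot H for Num.conj}.
Hypothesis hn : hilbert_norm ip.
Implicit Types (a : R[i]) (x y z u v : H) (A B S T X : H -> H).
Local Notation rip := (re_ip ip).

Lemma linD A x y : linear A -> A (x + y) = A x + A y.
Proof. by move=> lA; rewrite -[x in LHS]scale1r lA scale1r. Qed.
Lemma lin0 A : linear A -> A 0 = 0.
Proof.
move=> lA; have := linD 0 0 lA; rewrite addr0 => /eqP.
by rewrite -subr_eq0 opprD addNKr oppr_eq0 => /eqP.
Qed.
Lemma linZ A a x : linear A -> A (a *: x) = a *: A x.
Proof. by move=> lA; rewrite -[_ *: x in LHS]addr0 lA lin0// addr0. Qed.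
Lemma linB A x y : linear A -> A (x - y) = A x - A y.
Proof. by move=> lA; rewrite addrC -scaleN1r lA scaleN1r addrC. Qed.
Lemma lin_sum A I (r : seq I) (P : pred I) (F : I -> H) : linear A ->
  A (\sum_(i <- r | P i) F i) = \sum_(i <- r | P i) A (F i).
Proof.
by move=> lA; apply: (big_morph A) => [x y|]; rewrite ?linD ?lin0.
Qed.

(** Continuity over [R[i]] becomes an estimate with a real constant, the form in which boundedness
    is used throughout. *)
Lemma bounded_opP A : bounded_op A <->
  linear A /\ exists2 c : R, 0 <= c & forall x, nrm (A x) <= c * nrm x.
Proof.
split=> -[lA].
  move=> cA; split => //.
  pose f : {linear H -> H} := HB.pack A (GRing.isLinear.Build _ _ _ _ A lA).
  have : bounded_near f (nbhs (0 : H)) by apply/linear_bounded_continuous.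
  move=> /linear_boundedP /pinfty_ex_gt0[M M0 hM].
  have M_ : M = (Re M)%:C.
    by apply: complex_ext => //=; move: M0; rewrite ltcE => /andP[/eqP ->].
  rewrite M_ in M0 hM; exists (Re M); first by rewrite -ler0c ltW.
  by move=> x; have := hM x; rewrite /= !normE -rmorphM/= lecR.
move=> [c c0 cA]; split => //.
pose f : {linear H -> H} := HB.pack A (GRing.isLinear.Build _ _ _ _ A lA).
apply/(@linear_bounded_continuous _ _ _ f)/linear_boundedP.
exists c%:C; split; first by rewrite complex_real.
move=> r cr x; apply: (@le_trans _ _ (c%:C * `|x|)).
  by rewrite !normE -rmorphM/= lecR.
by rewrite ler_wpM2r// ltW.
Qed.

Lemma bounded_lin A : bounded_op A -> linear A. Proof. by case. Qed.

Lemma bounded_op0 : bounded_op (0 : H -> H).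
Proof.
apply/bounded_opP; split; first by move=> a x y; rewrite [RHS]addr0 [RHS]scaler0.
by exists 0 => // x; rewrite mul0r [X in nrm X](_ : _ = 0)// nrm0.
Qed.

Lemma bounded_op_lin a A B : bounded_op A -> bounded_op B ->
  bounded_op (a *: A + B).
Proof.
move=> /bounded_opP[lA [c c0 cA]] /bounded_opP[lB [d d0 dB]]; apply/bounded_opP.
split.
  move=> b x y; rewrite !fctE/= lA lB !scalerDr !scalerA (mulrC a).
  by rewrite -!addrA; congr (_ + _); rewrite addrCA.
exists (normc a * c + d) => [|x]; first by rewrite addr_ge0 ?mulr_ge0 ?normc_ge0.
rewrite !fctE; apply: le_trans (nrmD _ _) _; rewrite mulrDl nrmZ lerD//.
by rewrite -mulrA ler_wpM2l ?normc_ge0.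
Qed.

Lemma bounded_op_comp A B : bounded_op A -> bounded_op B -> bounded_op (A \o B).
Proof.
move=> /bounded_opP[lA [c c0 cA]] /bounded_opP[lB [d d0 dB]]; apply/bounded_opP.
split; first by move=> b x y /=; rewrite lB lA.
exists (c * d) => [|x /=]; first by rewrite mulr_ge0.
by apply: le_trans (cA _) _; rewrite -mulrA ler_wpM2l.
Qed.

Lemma adj_sym A B : is_adjoint ip A B -> is_adjoint ip B A.
Proof. by move=> h x y; rewrite ipC -h -ipC. Qed.

(** From [|B x|^2 = <A B x, x> <= c |B x| |x|]. *)
Lemma adj_nrm A B c : is_adjoint ip A B -> 0 <= c ->
  (forall x, nrm (A x) <= c * nrm x) -> forall x, nrm (B x) <= c * nrm x.
Proof.
move=> AB c0 cA x; have [->|b0] := eqVneq (nrm (B x)) 0.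
  by rewrite mulr_ge0 ?nrm_ge0.
have {}b0 : 0 < nrm (B x) by rewrite lt_def b0 nrm_ge0.
rewrite -(ler_pM2l b0) -expr2 -(ripxx hn) /re_ip -AB.
apply: le_trans (rip_le hn _ _) _.
by rewrite mulrA (mulrC _ c) ler_wpM2r ?nrm_ge0.
Qed.

Lemma adj_linear A B : is_adjoint ip A B -> linear B.
Proof.
move=> AB a x y; apply: (ip_sep hn) => z.
by rewrite ipC -AB ipDr ipZr [RHS]ipC ipDr ipZr !AB.
Qed.

Lemma adj_bounded A B : bounded_op A -> is_adjoint ip A B -> bounded_op B.
Proof.
move=> /bounded_opP[lA [c c0 cA]] AB; apply/bounded_opP; split.
  exact: adj_linear AB.
by exists c => //; exact: adj_nrm cA.
Qed.

Lemma adj_rip A B x y : is_adjoint ip A B -> rip (A x) y = rip x (B y).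
Proof. by move=> AB; rewrite /re_ip AB. Qed.

(** [x + y] gives [f x y + f y x = 0] and [x + i y] gives [f x y - f y x = 0]. Over complex scalars
    this makes positive operators self-adjoint and lets the diagonal determine an operator. *)
Lemma polarization0 (f : H -> H -> R[i]) :
  (forall x y z, f (x + y) z = f x z + f y z) ->
  (forall x y z, f z (x + y) = f z x + f z y) ->
  (forall a x z, f (a *: x) z = a * f x z) ->
  (forall a x z, f z (a *: x) = (a^*)%C * f z x) ->
  (forall x, f x x = 0) -> forall x y, f x y = 0.
Proof.
move=> fDl fDr fZl fZr f0 x y.
have h1 : f x y + f y x = 0.
  by have := f0 (x + y); rewrite fDl !fDr !f0 add0r addr0.
have h2 : f x y - f y x = 0.
  have := f0 (x + 'i *: y); rewrite fDl !fDr !fZl !fZr !f0 add0r mulr0 mulr0 addr0.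
  have -> : ('i^*)%C = - 'i :> R[i] by apply: complex_ext; rewrite /= ?oppr0.
  rewrite mulNr addrC -mulrBr => /eqP; rewrite mulf_eq0 => /orP[|/eqP h].
    by move/eqP => /(congr1 (@Im _)) /= /eqP; rewrite oner_eq0.
  by apply/eqP; rewrite -opprB oppr_eq0; apply/eqP.
have : f x y *+ 2 = 0 by rewrite mulr2n -{1}[f x y](subrK (f y x)) h2 add0r addrC h1.
by move/eqP; rewrite mulrn_eq0 /= => /eqP.
Qed.

Lemma op_diag_eq A B : linear A -> linear B ->
  (forall x, ip (A x) x = ip (B x) x) -> A = B.
Proof.
move=> lA lB AB; apply/funext => x; apply: (ip_sep hn) => y; apply/eqP.
rewrite -subr_eq0; apply/eqP; move: x y.
apply: polarization0 => [x y z|x y z|a x z|a x z|x].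
- by rewrite !linD// !ipDl; ring.
- by rewrite !ipDr; ring.
- by rewrite !linZ// !ipZl; ring.
- by rewrite !ipZr; ring.
- by rewrite AB subrr.
Qed.

Lemma pos_selfadj S : positive_op ip S -> is_adjoint ip S S.
Proof.
move=> [[lS _] S0] x y; apply/eqP; rewrite -subr_eq0; apply/eqP; move: x y.
apply: polarization0 => [x y z|x y z|a x z|a x z|x].
- by rewrite linD// !ipDl; ring.
- by rewrite linD// !ipDr; ring.
- by rewrite linZ// !ipZl; ring.
- by rewrite linZ// !ipZr; ring.
- rewrite [X in _ - X]ipC; have := S0 x; case: (ip (S x) x) => b c.
  by rewrite lecE /= => /andP[/eqP -> _]; rewrite oppr0 subrr.
Qed.

Lemma pos_rip_ge0 S x : positive_op ip S -> 0 <= rip (S x) x.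
Proof. by move=> [_ /(_ x)]; rewrite lecE => /andP[]. Qed.

Lemma pos_ripE S x : positive_op ip S -> ip (S x) x = (rip (S x) x)%:C.
Proof.
move=> [_ /(_ x)]; rewrite lecE => /andP[/eqP h _].
by apply: complex_ext.
Qed.

Lemma pos_cauchy S x y : positive_op ip S ->
  rip (S x) y ^+ 2 <= rip (S x) x * rip (S y) y.
Proof.
move=> pS; have lS := bounded_lin pS.1.
apply: (@psd_cauchy _ _ (fun x y => rip (S x) y)).
- by move=> {}x {}y; rewrite (adj_rip _ _ (pos_selfadj pS)) ripC.
- by move=> {}x {}y z; rewrite linD// ripDl.
- by move=> r {}x z; rewrite linZ// ripZl.
- by move=> {}x; exact: pos_rip_ge0.
Qed.

Lemma pos_eq0 S x : positive_op ip S -> rip (S x) x = 0 -> S x = 0.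
Proof.
move=> pS Sx0; apply: (rip_self_eq0 hn); apply/eqP.
by rewrite -sqrf_eq0 eq_le sqr_ge0 andbT (le_trans (pos_cauchy _ _ pS))// Sx0 mul0r.
Qed.

Lemma pos_opD S T : positive_op ip S -> positive_op ip T -> positive_op ip (S + T).
Proof.
move=> [bS S0] [bT T0]; split; last by move=> x; rewrite fctE ipDl addr_ge0.
by have := bounded_op_lin 1 bS bT; rewrite scale1r.
Qed.

Lemma pos_op_conj X X' T : bounded_op X -> is_adjoint ip X X' ->
  positive_op ip T -> positive_op ip (X \o T \o X').
Proof.
move=> bX XX' [bT T0]; split; last by move=> x /=; rewrite XX'.
by apply: bounded_op_comp; [exact: bounded_op_comp|exact: adj_bounded XX'].
Qed.

Lemma compact_opD S T : compact_op S -> compact_op T -> compact_op (S + T).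
Proof.
move=> [bS cS] [bT cT]; split.
  by have := bounded_op_lin 1 bS bT; rewrite scale1r.
have hH := @norm_hausdorff _ H.
rewrite precompactE in cS; rewrite precompactE in cT.
have cST := compact_setX cS cT.
apply: (@precompact_subset _ _ ((fun xy : H * H => xy.1 + xy.2) @` (closure (S @` [set x | `|x| <= 1]) `*` closure (T @` [set x | `|x| <= 1])))).
  move=> _ [x x1 <-]; exists (S x, T x) => //; split; apply: subset_closure; by exists x.
apply: compact_precompact; first exact: norm_hausdorff.
apply: continuous_compact => //; apply: continuous_subspaceT => xy.
exact: add_continuous.
Qed.

Lemma compact_op_conj X X' T : bounded_op X -> bounded_op X' ->
  compact_op T -> compact_op (X \o T \o X').
Proof.
move=> bX bX' [bT cT]; split.
  by apply: bounded_op_comp => //; exact: bounded_op_comp.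
have [lX' [c c0 cX']] := (bounded_opP X').1 bX'.
rewrite precompactE in cT.
(* Dividing [X'] by [c1] keeps the unit ball in itself and [c1 *: X] makes up for it; [c + 1] stays
   invertible when the bound [c] is 0. *)
pose c1 : R[i] := (c + 1)%:C.
have c1n : c1 != 0 by rewrite -[0]/(0%:C) (inj_eq (@complexI R)) lt0r_neq0// ltr_wpDl.
have bcX : bounded_op (c1 *: X + 0).
  by apply: bounded_op_lin => //; exact: bounded_op0.
apply: (@precompact_subset _ _ ((c1 *: X + 0) @` closure (T @` [set x | `|x| <= 1]))).
  move=> _ [x x1 <-]; exists (T (c1^-1 *: X' x)).
    apply: subset_closure; exists (c1^-1 *: X' x) => //=.
    rewrite normrZ normrV ?unitfE// ler_pdivrMl ?normr_gt0// mulr1.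
    rewrite norm_normc normE lecR /c1 normc_real ger0_norm ?addr_ge0//.
    apply: le_trans (cX' x) _; rewrite -[leRHS]mulr1.
    apply: ler_pM; rewrite ?nrm_ge0 ?lerDl//.
    by move: x1; rewrite /= normE lecR.
  rewrite !fctE/= addr0 -(linZ _ _ (bounded_lin bX)) -(linZ _ _ (bounded_lin bT)).
  by rewrite scalerA mulfV// scale1r.
apply: compact_precompact; first exact: norm_hausdorff.
by apply: continuous_compact => //; apply: continuous_subspaceT; case: bcX.
Qed.

End operators.

(** * Finite orthonormal families: projections, Bessel, a dimension count, Gram-Schmidt *)

Section orthonormal.
Context {R : realType} {H : completeNormedModType R[i]}.
Variable ip : {dot H for Num.conj}.
Hypothesis hn : hilbert_norm ip.
Implicit Types (a : R[i]) (x y z : H) (e u v w : nat -> H) (A B S T X : H -> H).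
Local Notation rip := (re_ip ip).
Local Notation "''N' a" := (normc a ^+ 2) (at level 10, a at level 8).

Lemma normc_sqrE a : a * (a^*)%C = (normc a ^+ 2)%:C.
Proof. by rewrite normc_sqr add_Re2_Im2 sqr_normc. Qed.

Lemma ip1_nrm x : ip x x = 1 -> nrm x = 1.
Proof. by move=> x1; apply/eqP; rewrite -sqrp_eq1 ?nrm_ge0// -(ripxx hn) /re_ip x1. Qed.

Definition perp (n : nat) v x := forall i, (i < n)%N -> ip x (v i) = 0.

Definition orth_proj (n : nat) v x := \sum_(j < n) ip x (v j) *: v j.

Lemma ip_proj_onto n v x i : orthonormal_upto ip n v -> (i < n)%N ->
  ip (orth_proj n v x) (v i) = ip x (v i).
Proof.
move=> ov ltin; rewrite /orth_proj ip_suml (bigD1 (Ordinal ltin))//= ipZl ov// eqxx mulr1.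
rewrite big1 ?addr0// => j ji; rewrite ipZl ov//.
by rewrite (_ : _ == _ = false) ?mulr0//; apply/negbTE; move: ji; rewrite -val_eqE.
Qed.

Lemma perp_sub_proj n v x : orthonormal_upto ip n v -> perp n v (x - orth_proj n v x).
Proof. by move=> ov i ltin; rewrite ipBl ip_proj_onto// subrr. Qed.

Lemma perp_proj n v x y : perp n v x -> ip x (orth_proj n v y) = 0.
Proof.
by move=> px; rewrite /orth_proj ip_sumr big1// => j _; rewrite ipZr px// mulr0.
Qed.

Lemma nrm_proj_onto n v x : orthonormal_upto ip n v ->
  nrm (orth_proj n v x) ^+ 2 = \sum_(j < n) 'N (ip x (v j)).
Proof.
move=> ov; apply: complexI; rewrite -(ip_self hn) {2}/orth_proj ip_sumr rmorph_sum/=.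
apply: eq_bigr => j _; rewrite ipZr ip_proj_onto//.
by rewrite -normc_sqrE mulrC.
Qed.

Lemma pythagoras n v x : orthonormal_upto ip n v ->
  nrm x ^+ 2 = \sum_(j < n) 'N (ip x (v j)) + nrm (x - orth_proj n v x) ^+ 2.
Proof.
move=> ov; rewrite -nrm_proj_onto//; set p := orth_proj n v x.
have xp : rip (x - p) p = 0 by rewrite /re_ip perp_proj//; exact: perp_sub_proj.
rewrite -!(ripxx hn) -[in LHS](subrK p x); move: xp; move: (x - p) => z xp.
by rewrite ripDl !ripDr xp [rip p _]ripC xp !addr0 add0r addrC.
Qed.

Lemma bessel n v x : orthonormal_upto ip n v ->
  \sum_(j < n) 'N (ip x (v j)) <= nrm x ^+ 2.
Proof. by move=> ov; rewrite (pythagoras x ov) lerDl sqr_ge0. Qed.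

Lemma nrm_lincomb n v (c : 'I_n -> R[i]) : orthonormal_upto ip n v ->
  nrm (\sum_j c j *: v j) ^+ 2 = \sum_j 'N (c j).
Proof.
move=> ov; set x := \sum_j _.
have xv (i : 'I_n) : ip x (v i) = c i.
  rewrite /x ip_suml (bigD1 i)//= ipZl ov// eqxx mulr1 big1 ?addr0// => j ji.
  by rewrite ipZl ov// (_ : _ == _ = false) ?mulr0//; apply/negbTE.
have <- : orth_proj n v x = x by apply: eq_bigr => j _; rewrite xv.
by rewrite nrm_proj_onto//; apply: eq_bigr => j _; rewrite xv.
Qed.

(** The coefficients are a kernel vector of an [(n + 1) x n] matrix. This is the dimension count
    behind the min-max arguments; the family [v] is arbitrary. *)
Lemma dim_gap n e v : orthonormal_upto ip n.+1 e ->
  exists c : 'I_n.+1 -> R[i], 0 < \sum_j 'N (c j) /\ perp n v (\sum_j c j *: e j).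
Proof.
move=> oe; pose A : 'M[R[i]]_(n.+1, n) := \matrix_(i, j) ip (e i) (v j).
have : kermx A != 0.
  rewrite -mxrank_eq0 mxrank_ker subn_eq0 -ltnNge.
  by apply: leq_ltn_trans (rank_leq_col A) _.
case/rowV0Pn => c /sub_kermxP cA c0; exists (fun j => c 0 j); split.
  rewrite lt_def sumr_ge0 ?andbT; last by move=> j _; rewrite sqr_ge0.
  apply: contra c0; rewrite psumr_eq0; last by move=> j _; rewrite sqr_ge0.
  move=> /allP h; apply/eqP/rowP => j; rewrite mxE.
  have := h j (mem_index_enum _); rewrite /= sqrf_eq0 => /eqP nc.
  apply/eqP; rewrite -normr_eq0 norm_normc nc.
  exact: eqxx.
move=> i ltin; rewrite ip_suml.
have := congr1 (fun M : 'rV[R[i]]_n => M 0 (Ordinal ltin)) cA.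
rewrite !mxE => h; rewrite -[RHS]h; apply: eq_bigr => j _.
by rewrite ipZl !mxE.
Qed.

Lemma normalize x : x != 0 -> nrm ((nrm x)^-1%:C *: x) = 1.
Proof.
move=> x0; have nx : nrm x != 0 by apply: contra x0 => /eqP /nrm_eq0 ->.
rewrite nrmZ normc_real ger0_norm ?invr_ge0 ?nrm_ge0//.
by rewrite mulVf.
Qed.

Lemma perpZ n v a x : perp n v x -> perp n v (a *: x).
Proof. by move=> px i ltin; rewrite ipZl px// mulr0. Qed.

(** Provided by the eigenbasis of [T], which is indexed by [nat]. It lets every finite orthonormal
    family be extended, so that no greedy sequence has to stop. *)
Definition inf_dim := exists e, forall n, orthonormal_upto ip n e.

Lemma exists_unit_perp n v : inf_dim -> exists2 x, nrm x = 1 & perp n v x.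
Proof.
move=> [e oe]; have [c [c0 pc]] := dim_gap v (oe n.+1).
exists ((nrm (\sum_j c j *: e j))^-1%:C *: \sum_j c j *: e j); last exact: perpZ.
apply: normalize; apply/eqP => x0; have := nrm_lincomb c (oe n.+1).
by rewrite x0 nrm0 expr0n => /eqP; rewrite eq_sym gt_eqF.
Qed.

Lemma orthonormal_upto_ext n v w : (forall i, (i < n)%N -> v i = w i) ->
  orthonormal_upto ip n v -> orthonormal_upto ip n w.
Proof. by move=> vw ov i j ltin ltjn; rewrite -!vw// ov. Qed.

Lemma orthonormal_uptoS n v x : orthonormal_upto ip n v -> nrm x = 1 -> perp n v x ->
  orthonormal_upto ip n.+1 (fun i => if i == n then x else v i).
Proof.
move=> ov x1 px i j; rewrite !ltnS.
have [->|ni] := eqVneq i n; have [->|nj] := eqVneq j n => lein lejn.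
- by rewrite (ip_self hn) x1 expr1n.
- by rewrite px// ltn_neqAle nj.
- rewrite ipC px; last by rewrite ltn_neqAle ni.
  by rewrite conjc0 (negbTE ni).
- by apply: ov; rewrite ltn_neqAle ?ni ?nj.
Qed.

Lemma proj_onto_ext n v w x : (forall i, (i < n)%N -> v i = w i) ->
  orth_proj n v x = orth_proj n w x.
Proof. by move=> vw; apply: eq_bigr => j _; rewrite vw. Qed.

Lemma proj_ontoS n v x : orth_proj n.+1 v x = orth_proj n v x + ip x (v n) *: v n.
Proof. by rewrite /orth_proj big_ord_recr. Qed.

(** The [x i] may be linearly dependent, yet [w] always has [n] members. That the span of [w]
    contains [x i] is expressed by the projection fixing [x i]. *)
Lemma gram_schmidt n (x : nat -> H) : inf_dim ->
  exists2 w, orthonormal_upto ip n w & forall i, (i < n)%N -> orth_proj n w (x i) = x i.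
Proof.
move=> infH; elim: n => [|n [w ow pw]]; first by exists (fun=> 0).
pose y := x n - orth_proj n w (x n).
have py : perp n w y by exact: perp_sub_proj.
(* The equation [y = <y, z> z] covers both cases: [z] is [y] normalized, or any unit vector
   orthogonal to [w] when the residue [y] is 0. *)
have [z [z1 pz yz]] : exists z, [/\ nrm z = 1, perp n w z & y = ip y z *: z].
  have [y0|y0] := eqVneq y 0.
    by have [z z1 pz] := exists_unit_perp n w infH; exists z; rewrite y0 ip0l scale0r.
  exists ((nrm y)^-1%:C *: y); split; [exact: normalize|exact: perpZ|].
  have ny : nrm y != 0 by apply: contra y0 => /eqP /nrm_eq0 ->.
  rewrite ipZr (ip_self hn) scalerA -[LHS]scale1r; congr (_ *: _).
  rewrite conjc_real -!rmorphM/= -[1]/(1%:C); congr (_%:C); field.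
  exact: ny.
exists (fun i => if i == n then z else w i); first exact: orthonormal_uptoS.
have pe t : orth_proj n (fun i => if i == n then z else w i) t = orth_proj n w t.
  by apply: proj_onto_ext => i ltin; rewrite ltn_eqF.
move=> i; rewrite ltnS leq_eqVlt proj_ontoS eqxx pe => /orP[/eqP ->|ltin].
  have -> : ip (x n) z = ip y z.
    by rewrite /y ipBl [ip (orth_proj _ _ _) _]ipC perp_proj// conjc0 subr0.
  by rewrite -yz /y addrC subrK.
rewrite pw//; have -> : ip (x i) z = 0.
  by rewrite -(pw i ltin) ipC perp_proj// conjc0.
by rewrite scale0r addr0.
Qed.

End orthonormal.

(** * Singular values and Ky Fan's principle *)

Section eigenvectors.
Context {R : realType} {H : completeNormedModType R[i]}.
Variable ip : {dot H for Num.conj}.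
Hypothesis hn : hilbert_norm ip.
Implicit Types (a : R[i]) (x y z : H) (e u v w : nat -> H) (s : nat -> R) (A B S T X : H -> H).
Local Notation rip := (re_ip ip).
Local Notation perp := (perp ip).
Local Notation proj_onto := (orth_proj ip).
Local Notation "''N' a" := (normc a ^+ 2) (at level 10, a at level 8).

Definition eigen_upto n S v s := forall i, (i < n)%N -> S (v i) = (s i)%:C *: v i.

Lemma perp_eigen n S v x : positive_op ip S ->
  (forall i, (i < n)%N -> exists c, S (v i) = c *: v i) -> perp n v x -> perp n v (S x).
Proof.
move=> pS ev px i ltin; rewrite (pos_selfadj pS).
by have [c ->] := ev i ltin; rewrite ipZr px// mulr0.
Qed.

Lemma eigen_decomp n S v s y : positive_op ip S -> orthonormal_upto ip n v ->
  eigen_upto n S v s ->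
  rip (S y) y = \sum_(j < n) s j * 'N (ip y (v j)) +
    rip (S (y - proj_onto n v y)) (y - proj_onto n v y).
Proof.
move=> pS ov ev; set p := proj_onto n v y.
have lS := bounded_lin pS.1.
have pz : perp n v (y - p) by exact: perp_sub_proj.
have pSz : perp n v (S (y - p)).
  by apply: perp_eigen => // i ltin; exists (s i)%:C; exact: ev.
have h1 : rip (S (y - p)) p = 0 by rewrite /re_ip perp_proj.
have h2 : rip (S p) (y - p) = 0 by rewrite (adj_rip _ _ (pos_selfadj pS)) ripC.
have h3 : rip (S p) p = \sum_(j < n) s j * 'N (ip y (v j)).
  rewrite {1}/p /orth_proj lin_sum// /re_ip ip_suml Re_sum.
  apply: eq_bigr => j _; rewrite linZ// ev// !ipZl [ip (v j) p]ipC /p ip_proj_onto//.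
  by rewrite mulrCA normc_sqrE ReM /= mul0r subr0.
move: h1 h2; rewrite -{3 4}(subrK p y); move: (y - p) => z h1 h2.
by rewrite linD// !(ripDl, ripDr) h1 h2 h3 addr0 add0r addrC.
Qed.

Lemma eigen_sum_ge n S v s y : positive_op ip S -> orthonormal_upto ip n v ->
  eigen_upto n S v s ->
  \sum_(j < n) s j * 'N (ip y (v j)) <= rip (S y) y.
Proof.
by move=> pS ov ev; rewrite (eigen_decomp y pS ov ev) lerDl pos_rip_ge0.
Qed.

Lemma le0_small (r C : R) : (forall d, 0 < d -> r <= C * d) -> r <= 0.
Proof.
move=> h; apply/ler_addgt0Pr => e e0.
have C1 : 0 < `|C| + 1 by rewrite ltr_wpDl.
rewrite add0r; apply: le_trans (h (e / (`|C| + 1)) _) _; first by rewrite divr_gt0.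
rewrite mulrCA -[leRHS]mulr1 ler_wpM2l ?(ltW e0)// ler_pdivrMr// mul1r.
by apply: le_trans (ler_norm _) _; rewrite lerDl.
Qed.

(** The supremum [s] of [<S x, x>] over the unit vectors orthogonal to [v] is attained by
    compactness: near maximizers have [|S x - s x|] small, and a cluster point [y] of the [S x]
    satisfies [|y| = s] and [S y = s y]. As the [v i] are eigenvectors, [S] preserves their
    orthogonal complement. *)
Lemma greedy_step n S v : inf_dim ip -> positive_op ip S -> compact_op S ->
  (forall i, (i < n)%N -> exists c, S (v i) = c *: v i) ->
  exists x (s : R), [/\ nrm x = 1, perp n v x, S x = s%:C *: x, 0 <= s
    & forall y, perp n v y -> rip (S y) y <= s * nrm y ^+ 2].
Proof.
move=> infH pS cS ev.
have [lS [c c0 cSb]] := (bounded_opP S).1 pS.1.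
pose E := [set r | exists x, [/\ nrm x = 1, perp n v x & r = rip (S x) x]].
have ubE : ubound E c.
  move=> _ [x [x1 _ ->]]; apply: le_trans (rip_le hn _ _) _.
  by have := cSb x; rewrite x1 !mulr1.
have [x0 x01 px0] := exists_unit_perp hn n v infH.
have supE : has_sup E by split; [exists (rip (S x0) x0), x0|exists c].
pose s := sup E.
have Es x : nrm x = 1 -> perp n v x -> rip (S x) x <= s.
  by move=> x1 px; apply: ub_le_sup; [exists c|exists x].
have s0 : 0 <= s by apply: le_trans (Es _ x01 px0); exact: pos_rip_ge0.
have Sle y : perp n v y -> rip (S y) y <= s * nrm y ^+ 2.
  move=> py; have [->|y0] := eqVneq y 0.
    by rewrite rip0r nrm0 expr0n mulr0.
  have := Es _ (normalize y0) (perpZ _ py).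
  rewrite linZ// ripZl ripZr mulrA -expr2 exprVn mulrC ler_pdivrMr// exprn_gt0//.
  by rewrite lt_def nrm_ge0 andbT; apply: contra y0 => /eqP /nrm_eq0 ->.
suff [x [x1 px Sx]] : exists x, [/\ nrm x = 1, perp n v x & S x = s%:C *: x].
  by exists x, s.
(* For [s = 0] the cluster point could not be normalized, but positivity then makes [S] vanish at
   [x0]. *)
have [seq0|sne0] := eqVneq s 0.
  exists x0; split => //; rewrite seq0 scale0r; apply: (pos_eq0 hn pS); apply/eqP.
  by rewrite eq_le (pos_rip_ge0 _ pS) andbT -seq0 Es.
have sgt0 : 0 < s by rewrite lt_def sne0.
(* Cauchy-Schwarz for the form [<S x, y>] at [x] and [S x], with the bound [s] applied to [S x]. *)
have S2 x : perp n v x -> nrm (S x) ^+ 2 <= s * rip (S x) x.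
  move=> px; have [->|Sx0] := eqVneq (nrm (S x) ^+ 2) 0.
    by rewrite mulr_ge0// pos_rip_ge0.
  have Sxgt : 0 < nrm (S x) ^+ 2 by rewrite lt_def Sx0 sqr_ge0.
  rewrite -(ler_pM2r Sxgt) -expr2 -{1}(ripxx hn).
  apply: le_trans (pos_cauchy _ _ pS) _.
  rewrite [s * _]mulrC -mulrA ler_wpM2l ?pos_rip_ge0//.
  by apply: Sle; exact: perp_eigen.
have S3 x : nrm x = 1 -> perp n v x -> nrm (S x - s%:C *: x) ^+ 2 <= s * (s - rip (S x) x).
  move=> x1 px; rewrite -(ripxx hn) ripBl !ripBr !ripZl !ripZr [rip x (S x)]ripC.
  by rewrite !(ripxx hn) x1; have := S2 x px; nra.
have approx (d : R) : 0 < d -> exists x, [/\ nrm x = 1, perp n v x & nrm (S x - s%:C *: x) < d].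
  move=> d0; have : 0 < d ^+ 2 / s by rewrite divr_gt0// exprn_gt0.
  move=> /sup_adherent /(_ supE) [_ [x [x1 px ->]] hx]; exists x; split => //.
  rewrite -(@ltr_pXn2r _ 2%N) ?nnegrE ?nrm_ge0 ?(ltW d0)//.
  apply: le_lt_trans (S3 x x1 px) _; rewrite -ltr_pdivlMl// mulrC.
  by rewrite -/s in hx; lra.
pose xs (k : nat) := projT1 (cid (approx k.+1%:R^-1 (ltac:(by rewrite invr_gt0)))).
have xsP k : [/\ nrm (xs k) = 1, perp n v (xs k) & nrm (S (xs k) - s%:C *: xs k) < k.+1%:R^-1].
  exact: (projT2 (cid (approx k.+1%:R^-1 (ltac:(by rewrite invr_gt0))))).
(* Every tail of [xs] meets every ball around the cluster point, so one [x] serves both estimates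
   and no subsequence is extracted. *)
have [y lim] : exists y, forall d, 0 < d -> exists x,
    [/\ nrm x = 1, perp n v x, nrm (S x - s%:C *: x) < d & nrm (S x - y) < d].
  have [_] := cS; rewrite precompactE => cK.
  have : ((S \o xs) @ \oo) (closure (S @` [set x | `|x| <= 1])).
    exists 0%N => // k _; apply: subset_closure; exists (xs k) => //=.
    by have [x1 _ _] := xsP k; rewrite normE x1.
  move=> /(cK _ _) [y [_ cy]]; exists y => d d0.
  have [N N0] : exists N : nat, N.+1%:R^-1 < d.
    by have [N _ /(_ N (leqnn N)) h] := near_infty_natSinv_lt (PosNum d0); exists N.
  have dC : 0 < d%:C by rewrite ltcR.
  have FN : ((S \o xs) @ \oo) [set S (xs k) | k in [set k | (N <= k)%N]].
    by exists N => // k Nk; exists k.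
  have [_ [[k Nk <-] yk]] := cy _ _ FN (nbhsx_ballx y d%:C dC).
  have [x1 px sx] := xsP k; exists (xs k); split => //.
    by apply: le_lt_trans N0; apply: le_trans (ltW sx) _; rewrite lef_pV2 ?posrE// ler_nat.
  by move: yk; rewrite -ball_normE /= -normrN opprB normE ltcR.
have sxy (d : R) : 0 < d -> exists x, [/\ nrm x = 1, perp n v x, nrm (S x - y) <= d & nrm (s%:C *: x - y) <= d + d].
  move=> /lim [x [x1 px sx xy]]; exists x; split => //; first exact: ltW.
  have -> : s%:C *: x - y = - (S x - s%:C *: x) + (S x - y).
    by rewrite opprB addrA subrK.
  by apply: le_trans (nrmD _ _) _; rewrite nrmN lerD// ltW.
have nsZ x : nrm (s%:C *: x) = s * nrm x.
  by rewrite nrmZ normc_real ger0_norm.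
have ny : nrm y = s.
  apply/eqP; rewrite -subr_eq0 -normr_le0; apply: (@le0_small _ 2) => d d0.
  have [x [x1 _ _ h]] := sxy d d0; rewrite ler_norml; apply/andP; split.
    have := nrmD (s%:C *: x - y) y; rewrite subrK nsZ x1; lra.
  have := nrmB (s%:C *: x) (s%:C *: x - y).
  by rewrite opprB addrC subrK nsZ x1; lra.
have Sy : S y = s%:C *: y.
  apply/eqP; rewrite -subr_eq0; apply/eqP/nrm_eq0/eqP; rewrite eq_le nrm_ge0 andbT.
  apply: (@le0_small _ (2 * c + s)) => d d0.
  have [x [x1 _ h1 h2]] := sxy d d0.
  have -> : S y - s%:C *: y = - S (s%:C *: x - y) + s%:C *: (S x - y).
    by rewrite (linB _ _ lS) (linZ _ _ lS) opprB scalerBr addrA subrK.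
  apply: le_trans (nrmD _ _) _; rewrite nrmN nsZ.
  have := cSb (s%:C *: x - y); have := nrm_ge0 (S x - y); nra.
have py : perp n v y.
  move=> i ltin; apply/eqP; rewrite -normr_eq0 norm_normc -[0]/(0%:C) (inj_eq (@complexI R)).
  rewrite eq_le normc_ge0 andbT; apply: (@le0_small _ (2 * nrm (v i))) => d d0.
  have [x [x1 px _ h]] := sxy d d0.
  have -> : ip y (v i) = - ip (s%:C *: x - y) (v i) by rewrite ipBl ipZl px// mulr0 add0r opprK.
  rewrite -ipNl; apply: le_trans (normc_ip hn _ _) _; rewrite nrmN.
  by have := nrm_ge0 (v i); nra.
have y0 : y != 0 by apply: contra_neq sne0 => y0; rewrite -ny y0 nrm0.
exists ((nrm y)^-1%:C *: y); split; [exact: normalize|exact: perpZ|].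
by rewrite linZ// Sy !scalerA mulrC.
Qed.

End eigenvectors.

Section singular_values.
Context {R : realType} {H : completeNormedModType R[i]}.
Variable ip : {dot H for Num.conj}.
Hypothesis hn : hilbert_norm ip.
Implicit Types (a : R[i]) (x y z : H) (e u v w : nat -> H) (s : nat -> R) (A B S T X : H -> H).
Local Notation rip := (re_ip ip).
Local Notation perp := (perp ip).
Local Notation proj_onto := (orth_proj ip).
Local Notation "''N' a" := (normc a ^+ 2) (at level 10, a at level 8).

(** Eigenvectors in the order of the min-max principle. By the last clause nothing larger than [s n]
    is left after [n] steps; it makes [s] nonincreasing. *)
Definition greedy S v s : Prop :=
  [/\ forall n, orthonormal_upto ip n v,
      forall n, eigen_upto n S v s,
      forall n, 0 <= s n
    & forall n y, perp n v y -> rip (S y) y <= s n * nrm y ^+ 2].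

(* [Q] restricts where the vectors are picked: among all eigenvectors, or in
   a given eigenbasis. *)
Lemma greedy_seq S (Q : H -> Prop) :
  (forall n v, (forall i, (i < n)%N -> Q (v i)) ->
    exists x (r : R), [/\ Q x, nrm x = 1, perp n v x &
     [/\ S x = r%:C *: x, 0 <= r
    & forall y, perp n v y -> rip (S y) y <= r * nrm y ^+ 2]]) ->
  exists v s, (forall n, Q (v n)) /\ greedy S v s.
Proof.
move=> step.
pose good n v (xr : H * R) := [/\ Q xr.1, nrm xr.1 = 1, perp n v xr.1 &
     [/\ S xr.1 = xr.2%:C *: xr.1, 0 <= xr.2
    & forall y, perp n v y -> rip (S y) y <= xr.2 * nrm y ^+ 2]].
have /choice [pick pickP] : forall nv : nat * (nat -> H), exists xr : H * R,
    (forall i, (i < nv.1)%N -> Q (nv.2 i)) -> good nv.1 nv.2 xr.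
  move=> [n v]; have [h|h] := pselect (forall i, (i < n)%N -> Q (v i)).
    by have [x [r h']] := step n v h; exists (x, r).
  by exists (0, 0).
(* [F n] carries the first [n] picks and is 0 elsewhere, since each pick depends on all earlier
   ones. *)
pose F := fix F n := if n is m.+1 then
  fun i => if i == m then (pick (m, F m)).1 else F m i else fun=> 0.
pose v n := (pick (n, F n)).1; pose s n := (pick (n, F n)).2.
have Fv n i : (i < n)%N -> F n i = v i.
  elim: n => // n IH; rewrite ltnS leq_eqVlt /=.
  by have [-> //|ni] := eqVneq i n; move=> /= /IH.
have Qv n : (forall i, (i < n)%N -> Q (v i)) /\ good n v (v n, s n).
  elim: n => [|n [IH [q1 q2 q3 [q4 q5 q6]]]].
    split => //; have [//|q1 q2 q3 [q4 q5 q6]] := pickP (0%N, F 0%N).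
    by split => //; split => // y _; exact: q6.
  have IH' i : (i < n.+1)%N -> Q (v i).
    by rewrite ltnS leq_eqVlt => /orP[/eqP ->|]; [|exact: IH].
  split => //; have [|p1 p2 p3 [p4 p5 p6]] := pickP (n.+1, F n.+1).
    by move=> i /= lti; have := Fv n.+1 i lti; rewrite /= => ->; exact: IH'.
  have pe y : perp n.+1 (F n.+1) y <-> perp n.+1 v y.
    by split => h i lti; have := h i lti; rewrite Fv.
  by split; rewrite //=; [exact/pe|split => // y /pe; exact: p6].
exists v, s; split; first by move=> n; apply: (Qv n.+1).1.
have ov n : orthonormal_upto ip n v.
  elim: n => // n IH; have [_ [_ x1 px _]] := Qv n.
  apply: (orthonormal_upto_ext _ (orthonormal_uptoS hn IH x1 px)) => i _ /=.
  by case: eqVneq => // ->.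
split => //.
- by move=> n i _; have [_ [_ _ _ []]] := Qv i.
- by move=> n; have [_ [_ _ _ []]] := Qv n.
- by move=> n; have [_ [_ _ _ []]] := Qv n.
Qed.

Lemma exists_greedy S : inf_dim ip -> positive_op ip S -> compact_op S ->
  exists v s, greedy S v s.
Proof.
move=> infH pS cS.
have [|v [s [_ g]]] := @greedy_seq S (fun x => exists c, S x = c *: x); last by exists v, s.
move=> n v ev; have [x [s [x1 px Sx s0 h]]] := greedy_step hn infH pS cS ev.
by exists x, s; split => //; exists s%:C.
Qed.

(** The maximizer [x] need not be a basis vector, but by completeness some [e m] is not orthogonal
    to it. Self-adjointness gives [e m] the same eigenvalue, and [e m] is new because [x] is
    orthogonal to the earlier picks. The map [m] need not be onto: it can miss vectors of the
    kernel. *)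
Lemma exists_greedy_basis S e : positive_op ip S -> compact_op S ->
  complete_orthonormal ip e -> (forall m, exists c, S (e m) = c *: e m) ->
  exists (m : nat -> nat) s, greedy S (e \o m) s.
Proof.
move=> pS cS [oe ce] ev.
have infH : inf_dim ip by exists e => n i j _ _; exact: oe.
have [|v [s [Qv g]]] := @greedy_seq S (fun x => exists m, x = e m); last first.
  have [m hm] := choice Qv; exists m, s.
  by rewrite (_ : e \o m = v)//; apply/funext => n /=; rewrite hm.
move=> n v Qv.
have evv i : (i < n)%N -> exists c, S (v i) = c *: v i.
  by move=> lti; have [m ->] := Qv i lti; exact: ev.
have [x [r [x1 px Sx r0 hr]]] := greedy_step hn infH pS cS evv.
have [m xm] : exists m, ip x (e m) != 0.
  apply: contrapT => h; have x0 : x = 0.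
    by apply: ce => i; apply: contrapT => /eqP hi; apply: h; exists i.
  by move: x1; rewrite x0 nrm0 => /eqP; rewrite eq_sym oner_eq0.
exists (e m), r; split; [by exists m| | |split => //].
- by apply: (ip1_nrm hn); rewrite oe eqxx.
- move=> i lti; have [k vk] := Qv i lti; rewrite vk oe.
  case: eqVneq => // mk; move: xm; rewrite mk -vk px// eqxx //.
- have [c Sc] := ev m; rewrite Sc; congr (_ *: _).
  have := pos_selfadj pS x (e m); rewrite Sx Sc ipZl ipZr => /(mulIf xm).
  by move=> h; rewrite -[c]conjcK -h conjc_real.
Qed.

Section greedy_theory.
Variables (S : H -> H) (v : nat -> H) (s : nat -> R).
Hypotheses (pS : positive_op ip S) (gS : greedy S v s).

Let ov n : orthonormal_upto ip n v. Proof. by case: gS. Qed.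
Let ev n : eigen_upto n S v s. Proof. by case: gS. Qed.

Lemma greedy_unit n : nrm (v n) = 1.
Proof.
by apply: (ip1_nrm hn); rewrite (@ov n.+1)// eqxx.
Qed.

Lemma greedy_rip n : rip (S (v n)) (v n) = s n.
Proof. by rewrite (@ev n.+1)// ripZl (ripxx hn) greedy_unit expr1n mulr1. Qed.

Lemma greedy_noninc m n : (m <= n)%N -> s n <= s m.
Proof.
move=> mn; rewrite -(greedy_rip n).
have [_ _ _ /(_ m (v n))] := gS; rewrite greedy_unit expr1n mulr1; apply.
move=> i im; rewrite (@ov n.+1)//; last by rewrite ltnS ltnW// (leq_trans im).
by rewrite gtn_eqF// (leq_trans im).
Qed.

(** The vector [z = S x - l x] satisfies [S z = - l z], which positivity excludes for [l > 0] unless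
    [z = 0]; for [l = 0] one has [|S x|^2 = <S^2 x, x> = 0]. *)
Lemma abs_eigen_pos l x : abs_eigenvector ip S l x -> S x = l%:C *: x.
Proof.
move=> [l0 [S' SS' S'Sx]].
have lS := bounded_lin pS.1.
have S'E : S' = S.
  by apply/funext => z; apply: (ip_sep hn) => y; rewrite ipC -SS' (pos_selfadj pS) -ipC.
rewrite S'E in S'Sx.
pose z := S x - l%:C *: x.
have Sz : S z = - l%:C *: z.
  rewrite /z (linB _ _ lS) (linZ _ _ lS) S'Sx scaleNr scalerBr opprB scalerA -rmorphM.
  by rewrite -expr2 addrC.
suff z0 : z = 0 by apply/eqP; rewrite -subr_eq0; apply/eqP.
have := pos_rip_ge0 z pS; rewrite Sz scaleNr ripNl ripZl oppr_ge0 => h.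
have [l00|ln0] := eqVneq l 0.
  rewrite /z l00 scale0r subr0; apply: (rip_self_eq0 hn).
  by rewrite (adj_rip _ _ (pos_selfadj pS)) S'Sx l00 expr0n scale0r rip0r.
apply: (rip_self_eq0 hn); apply/eqP; rewrite eq_le (ripxx hn) sqr_ge0 andbT.
by rewrite (ripxx hn) pmulr_rle0 in h; rewrite // lt_def ln0.
Qed.

(** Given [n + 1] orthonormal eigenvectors with eigenvalues at least [l], some combination is
    orthogonal to the first [n] greedy vectors, where the form is at most [s n]. The greedy vectors
    themselves attain the bound. *)
Lemma mu_greedy n : mu ip S n = s n.
Proof.
have [_ _ s0 gle] := gS.
have ubn l : (exists2 e, orthonormal_upto ip n.+1 e &
         forall i, (i < n.+1)%N -> exists2 l', l <= l' &
           abs_eigenvector ip S l' (e i)) -> l <= s n.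
  move=> [e oe he].
  have /choice [l' hl'] : forall i : 'I_n.+1, exists l', l <= l' /\ S (e i) = l'%:C *: e i.
    by move=> i; have [l' ll' /abs_eigen_pos] := he i (ltn_ord i); exists l'.
  have [c [c0 pc]] := dim_gap v oe.
  have := gle n _ pc; set x := \sum_j _.
  have -> : rip (S x) x = \sum_j l' j * 'N (c j).
    rewrite /re_ip {1}/x (lin_sum _ _ _ (bounded_lin pS.1)) ip_suml Re_sum.
    apply: eq_bigr => j _; rewrite (linZ _ _ (bounded_lin pS.1)) (hl' j).2.
    have -> : ip (c j *: ((l' j)%:C *: e j)) x = (l' j)%:C * (c j * (c j)^*%C).
      rewrite ipZl ipZl mulrCA; congr (_ * (_ * _)).
      rewrite /x ip_sumr (bigD1 j)//= ipZr oe// eqxx mulr1 big1 ?addr0// => k kj.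
      rewrite ipZr oe// (_ : _ == _ = false) ?mulr0//; apply/negbTE.
      by rewrite eq_sym; exact: kj.
    by rewrite normc_sqrE -rmorphM.
  rewrite (nrm_lincomb hn _ oe) => h; rewrite -(ler_pM2r c0); apply: le_trans h.
  rewrite mulr_sumr; apply: ler_sum => j _.
  by rewrite ler_wpM2r ?sqr_ge0//; exact: (hl' j).1.
have sn : [set l | exists2 e, orthonormal_upto ip n.+1 e &
         forall i, (i < n.+1)%N -> exists2 l', l <= l' &
           abs_eigenvector ip S l' (e i)] (s n).
  exists v => // i lti; exists (s i); first exact: greedy_noninc.
  split => //; exists S; first exact: pos_selfadj.
  rewrite !(@ev n.+1)// (linZ _ _ (bounded_lin pS.1)) (@ev n.+1)// scalerA.
  by rewrite -rmorphM -expr2.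
apply/eqP; rewrite eq_le; apply/andP; split.
  by apply: ge_sup; [exists (s n)|move=> l /ubn].
by apply: ub_le_sup => //; exists (s n) => l /ubn.
Qed.

(** Only these two consequences of orthonormality matter for Ky Fan's bound. Orthonormal [u] have
    [c = 1]; vectors [X' (w i)] with [w] orthonormal have for [c] the square of a bound on [X]. *)
Lemma greedy_kyfan n u (c : R) :
  (forall i, (i < n)%N -> nrm (u i) ^+ 2 <= c) ->
  (forall j, (j < n)%N -> \sum_(i < n) 'N (ip (u i) (v j)) <= c) ->
  \sum_(i < n) rip (S (u i)) (u i) <= c * \sum_(j < n) s j.
Proof.
move=> uc uv; have [_ _ s0 gle] := gS.
(* With [s n] split off from each eigenvalue the weights [s j - s n] are nonnegative, and the terms
   in [s n] cancel after summation. *)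
have ptw y : rip (S y) y <= s n * nrm y ^+ 2 + \sum_(j < n) (s j - s n) * 'N (ip y (v j)).
  rewrite (eigen_decomp y pS (@ov n) (@ev n)) (pythagoras hn y (@ov n)).
  rewrite mulrDr mulr_sumr -addrA [X in _ <= _ + X]addrC addrA -big_split /=.
  apply: lerD; last by apply: gle; exact: perp_sub_proj.
  by apply: ler_sum => j _; rewrite -mulrDl addrC subrK.
apply: (@le_trans _ _ (\sum_(i < n) (s n * nrm (u i) ^+ 2 +
    \sum_(j < n) (s j - s n) * 'N (ip (u i) (v j))))).
  by apply: ler_sum => i _; exact: ptw.
rewrite big_split/= exchange_big/= -mulr_sumr.
apply: (@le_trans _ _ (s n * (\sum_(i < n) c) + \sum_(j < n) (s j - s n) * c)).
  apply: lerD; first by rewrite ler_wpM2l//; apply: ler_sum => i _; exact: uc.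
  apply: ler_sum => j _; rewrite -mulr_sumr ler_wpM2l//; last exact: uv.
  by rewrite subr_ge0; apply: greedy_noninc; exact: ltnW.
rewrite -mulr_suml sumrB !sumr_const card_ord -[c *+ n]mulr_natl -[s n *+ n]mulr_natl.
by rewrite le_eqVlt; apply/orP; left; apply/eqP; ring.
Qed.

End greedy_theory.

Definition ksum S n := \sum_(j < n) mu ip S j.

Lemma ksum_greedy S v s n : positive_op ip S -> greedy S v s ->
  ksum S n = \sum_(j < n) s j.
Proof. by move=> pS g; apply: eq_bigr => j _; exact: (mu_greedy pS g). Qed.

Hypothesis infH : inf_dim ip.

Lemma mu_ge0 S n : positive_op ip S -> compact_op S -> 0 <= mu ip S n.
Proof.
by move=> pS cS; have [v [s g]] := exists_greedy infH pS cS; rewrite (mu_greedy pS g); case: g.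
Qed.

Lemma ksum_mono S m n : positive_op ip S -> compact_op S -> (m <= n)%N ->
  ksum S m <= ksum S n.
Proof.
move=> pS cS mn; rewrite /ksum -!(big_mkord xpredT (mu ip S)) (big_cat_nat (leq0n m) mn)/= lerDl.
by apply: sumr_ge0 => i _; exact: mu_ge0.
Qed.

Lemma kyfan S u n : positive_op ip S -> compact_op S -> orthonormal_upto ip n u ->
  \sum_(i < n) rip (S (u i)) (u i) <= ksum S n.
Proof.
move=> pS cS ou; have [v [s g]] := exists_greedy infH pS cS.
rewrite (ksum_greedy n pS g) -[leRHS]mul1r; apply: (greedy_kyfan pS g).
  by move=> i lti; rewrite -(ripxx hn) /re_ip ou// eqxx.
move=> j _; rewrite -[X in _ <= X](expr1n _ 2%N) -(greedy_unit g j).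
apply: le_trans (bessel hn (v j) ou); apply: ler_sum => i _.
by rewrite ipC normcJ.
Qed.

Lemma ksumE S n : positive_op ip S -> compact_op S ->
  exists2 u, orthonormal_upto ip n u & ksum S n = \sum_(i < n) rip (S (u i)) (u i).
Proof.
move=> pS cS; have [v [s g]] := exists_greedy infH pS cS; exists v; first by case: g.
by rewrite (ksum_greedy n pS g); apply: eq_bigr => i _; rewrite (greedy_rip g).
Qed.

(** [greedy_kyfan] applies to the vectors [X' (u i)]: their norms are at most [c], and the sums over
    [i] are bounded by Bessel's inequality for [X (v j)]. *)
Lemma ksum_conj_le X X' T (c : R) n : positive_op ip T -> compact_op T ->
  bounded_op X -> is_adjoint ip X X' -> 0 <= c ->
  (forall x, nrm (X x) <= c * nrm x) ->
  ksum (X \o T \o X') n <= c ^+ 2 * ksum T n.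
Proof.
move=> pT cT bX XX' c0 cX.
have pXT := pos_op_conj hn bX XX' pT.
have cXT := compact_op_conj bX (adj_bounded hn bX XX') cT.
have [u ou ->] := ksumE n pXT cXT.
have [v [s g]] := exists_greedy infH pT cT; rewrite (ksum_greedy n pT g).
have -> : \sum_(i < n) rip ((X \o T \o X') (u i)) (u i) =
    \sum_(i < n) rip (T ((X' \o u) i)) ((X' \o u) i).
  by apply: eq_bigr => i _; rewrite /= (adj_rip _ _ XX').
apply: (greedy_kyfan pT g).
  move=> i lti /=; rewrite ler_sqr ?nnegrE ?nrm_ge0//.
  apply: le_trans (adj_nrm hn XX' c0 cX (u i)) _.
  rewrite [X in _ * X](_ : _ = 1) ?mulr1//.
  by apply: (ip1_nrm hn); rewrite ou// eqxx.
move=> j _; apply: (@le_trans _ _ (nrm (X (v j)) ^+ 2)).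
  apply: le_trans (bessel hn (X (v j)) ou); apply: ler_sum => i _ /=.
  by rewrite XX' [ip (v j) _]ipC normcJ.
rewrite ler_sqr ?nnegrE ?nrm_ge0//; apply: le_trans (cX _) _.
by rewrite (greedy_unit g) mulr1.
Qed.

(** The trial vectors are an orthonormal [w] whose span contains the [X (v i)]: each
    [<T X' w_j, X' w_j>] dominates [sum_i s_i |<X v_i, w_j>|^2], and summing over [j] recovers
    [|X v_i|^2]. This is what makes the defect nonnegative. *)
Lemma ksum_conj_ge X X' T v s n : positive_op ip T -> compact_op T -> greedy T v s ->
  bounded_op X -> is_adjoint ip X X' ->
  \sum_(i < n) s i * nrm (X (v i)) ^+ 2 <= ksum (X \o T \o X') n.
Proof.
move=> pT cT g bX XX'.
have pXT := pos_op_conj hn bX XX' pT.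
have cXT := compact_op_conj bX (adj_bounded hn bX XX') cT.
have [w ow pw] := gram_schmidt hn n (X \o v) infH.
apply: le_trans (kyfan pXT cXT ow).
have [ov ev s0 _] := g.
have ge j : (j < n)%N -> \sum_(i < n) s i * 'N (ip (X (v i)) (w j)) <=
    rip ((X \o T \o X') (w j)) (w j).
  move=> ltj; rewrite /= (adj_rip _ _ XX').
  apply: le_trans (eigen_sum_ge _ pT (ov n) (ev n)).
  by apply: ler_sum => i _; rewrite XX' [ip (v i) _]ipC normcJ.
apply: (@le_trans _ _ (\sum_(j < n) \sum_(i < n) s i * 'N (ip (X (v i)) (w j)))); last first.
  by apply: ler_sum => j _; exact: ge.
rewrite exchange_big/=; apply: ler_sum => i _.
by rewrite -mulr_sumr -(nrm_proj_onto hn _ ow) pw.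
Qed.

Lemma ksumD_le S T n : positive_op ip S -> compact_op S ->
  positive_op ip T -> compact_op T -> ksum (S + T) n <= ksum S n + ksum T n.
Proof.
move=> pS cS pT cT.
have [u ou ->] := ksumE n (pos_opD pS pT) (compact_opD cS cT).
apply: (@le_trans _ _ (\sum_(i < n) rip (S (u i)) (u i) + \sum_(i < n) rip (T (u i)) (u i))).
  by rewrite -big_split /=; apply: ler_sum => i _; rewrite fctE ripDl.
by rewrite lerD ?kyfan.
Qed.

(** The span of [2 n] orthonormal trial vectors contains the top [n] eigenvectors of both operators,
    so each form picks up at least its own [n] eigenvalues. Dependence between the two lists is
    harmless in [gram_schmidt]. *)
Lemma ksumD_ge S T n : positive_op ip S -> compact_op S ->
  positive_op ip T -> compact_op T -> ksum S n + ksum T n <= ksum (S + T) (2 * n)%N.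
Proof.
move=> pS cS pT cT.
have [v [s g]] := exists_greedy infH pS cS; have [v' [s' g']] := exists_greedy infH pT cT.
have [w ow pw] := gram_schmidt hn (2 * n)%N (fun i => if (i < n)%N then v i else v' (i - n)%N) infH.
apply: le_trans (kyfan (pos_opD pS pT) (compact_opD cS cT) ow).
have -> : \sum_(i < 2 * n) rip ((S + T) (w i)) (w i) =
    \sum_(i < 2 * n) rip (S (w i)) (w i) + \sum_(i < 2 * n) rip (T (w i)) (w i).
  by rewrite -big_split; apply: eq_bigr => i _; rewrite fctE ripDl.
have half Q (x : nat -> H) (r : nat -> R) : positive_op ip Q -> greedy Q x r ->
    (forall i, (i < n)%N -> proj_onto (2 * n)%N w (x i) = x i) ->
    ksum Q n <= \sum_(i < 2 * n) rip (Q (w i)) (w i).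
  move=> pQ gQ px; rewrite (ksum_greedy n pQ gQ); have [ox ex r0 _] := gQ.
  apply: (@le_trans _ _ (\sum_(i < 2 * n) \sum_(j < n) r j * 'N (ip (w i) (x j)))); last first.
    by apply: ler_sum => i _; apply: eigen_sum_ge.
  rewrite exchange_big/=; apply: ler_sum => i _; rewrite -mulr_sumr.
  under eq_bigr do rewrite ipC normcJ.
  by rewrite -(nrm_proj_onto hn _ ow) px// (greedy_unit gQ) expr1n mulr1.
apply: lerD; first by apply: (half _ _ _ pS g) => i lti; have := pw i; rewrite lti mul2n -addnn; apply; exact: ltn_addr.
apply: (half _ _ _ pT g') => i lti; have := pw (n + i)%N.
have -> : (n + i < n)%N = false by rewrite ltnNge leq_addr.
by rewrite addKn; apply; rewrite mul2n -addnn ltn_add2l.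
Qed.

End singular_values.

(** * The functional [Lmap xi] *)

Section integral_shift.
Context {R : realType}.
Local Notation mu := (@lebesgue_measure R).
Local Notation TR := (measurableTypeR R).

Let shift (c : R) : TR -> TR := fun t => (t : R) + c.

Let measurable_shift c : measurable_fun setT (shift c).
Proof. by apply: measurable_funD => //; exact: measurable_id. Qed.

Let mshift c : {mfun TR >-> TR} :=
  HB.pack (shift c) (isMeasurableFun.Build _ _ _ _ _ (measurable_shift c)).

(** Lebesgue measure is determined by its values on half-open intervals, which the shift
    permutes. *)
Lemma lebesgue_measure_shift (c : R) (A : set R) : measurable A ->
  pushforward mu (shift c) A = mu A.
Proof.
move=> mA; apply/esym.
apply: (@lebesgue_measure_unique R (pushforward mu (mshift c))) => //= _ [[a b]] _ <-.
rewrite /pushforward /=.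
rewrite (_ : _ @^-1` _ = `]a - c, b - c]%classic); last first.
  by apply/seteqP; split => x /=; rewrite /shift !in_itv/= ltrBlDr lerBrDr.
rewrite !lebesgue_measure_itv/= !lte_fin ltrD2r.
by case: ifP => // _; rewrite -!EFinB; congr EFin; ring.
Qed.

Lemma Rintegral_shift (f : R -> R) (c a b : R) : measurable_fun setT f ->
  mu.-integrable `[a, b] (EFin \o (fun t => f (t + c))) ->
  \int[mu]_(t in `[a, b]) f (t + c) = \int[mu]_(t in `[a + c, b + c]) f t.
Proof.
move=> mf intf; rewrite /Rintegral; congr fine.
have E : `[a, b]%classic = shift c @^-1` `[a + c, b + c].
  by apply/seteqP; split => x /=; rewrite !in_itv/= !lerD2r.
rewrite E in intf *.
rewrite -(@integral_pushforward _ _ TR TR R (shift c) (measurable_shift c) mu _ (EFin \o f))//.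
  apply: (@eq_measure_integral _ TR R _ mu (pushforward mu (mshift c))) => A mA _ /=.
  exact: lebesgue_measure_shift.
exact/measurable_EFinP.
Qed.

End integral_shift.

Section sequences.
Context {R : realType}.
Implicit Types (a b c : nat -> R).
Local Notation mu := (@lebesgue_measure R).

Lemma step_term_eq0 a (s : R) (k : nat) : s < k.+1%:R ->
  a k * \1_`[k.+1%:R, k.+2%:R[ s = 0.
Proof.
move=> sk; rewrite indicE memNset ?mulr0//= in_itv/= => /andP[].
by rewrite leNgt sk.
Qed.

(** At a fixed point at most one term is nonzero, so the limit defining [step_fun] is that of an
    eventually constant sequence. *)
Lemma step_fun_near a (s : R) :
  \forall n \near \oo, series (fun k => a k * \1_`[k.+1%:R, k.+2%:R[ s) n = step_fun a s.
Proof.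
pose N := Num.truncn s.
have sN : s < N.+1%:R by exact: truncnS_gt.
have cst n : (N <= n)%N -> series (fun k => a k * \1_`[k.+1%:R, k.+2%:R[ s) n = series (fun k => a k * \1_`[k.+1%:R, k.+2%:R[ s) N.
  move=> Nn; rewrite /series /= (big_cat_nat (leq0n N) Nn)//= [X in _ + X]big1_seq ?addr0// => i /andP[_].
  rewrite mem_index_iota => /andP[Ni _]; apply: step_term_eq0.
  by apply: lt_le_trans sN _; rewrite ler_nat ltnS.
near=> n; rewrite /step_fun.
set l := series _ N in cst; rewrite (@lim_near_cst R _ _ _ _ l)//.
  by apply: cst; near: n; exact: nbhs_infty_ge.
by exists N => // m /= Nm; apply: cst.
Unshelve. all: by end_near. Qed.

Lemma step_funE a (s : R) (n : nat) : n.+1%:R <= s < n.+2%:R -> step_fun a s = a n.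
Proof.
move=> /andP[ns sn].
have [N _ h] := step_fun_near a s.
rewrite -(h (N + n.+1)%N) /= ?leq_addr//.
rewrite /series/= (big_cat_nat (n := n))//=; last by rewrite (leq_trans (leqnSn n))// leq_addl.
rewrite [X in _ + X]big_ltn; last by rewrite leq_addl.
rewrite indicE mem_set/=; last by rewrite in_itv/= ns.
rewrite big1_seq ?big1_seq ?mulr1 ?addr0 ?add0r//.
  move=> i /andP[_]; rewrite mem_index_iota => /andP[ni _]; apply: step_term_eq0.
  by apply: lt_le_trans sn _; rewrite ler_nat.
move=> i /andP[_]; rewrite mem_index_iota => /andP[_ ni].
rewrite indicE memNset ?mulr0//= in_itv/= => /andP[_]; apply/negP; rewrite -leNgt.
by apply: le_trans ns; rewrite ler_nat.
Qed.

Lemma measurable_step_exp a : measurable_fun setT (Linv (step_fun a)).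
Proof.
apply: (@measurable_fun_cvg _ _ _ _ (fun n t => series (fun k => a k * \1_`[k.+1%:R, k.+2%:R[ (expR t)) n)).
  move=> m; rewrite /series /=; apply: measurable_sum => i.
  apply: measurable_funM => //.
  apply: measurableT_comp; last exact: measurable_expR.
  by apply: measurable_indic; exact: measurable_itv.
move=> t _; apply: cvg_near_cst; exact: step_fun_near.
Qed.

(* The (0-based) index of the constant piece of [Linv (step_fun a)] at [t]. *)
Definition step_idx (t : R) : nat := (Num.truncn (expR t)).-1.

Lemma step_idxP t : 0 <= t -> (step_idx t).+1%:R <= expR t < (step_idx t).+2%:R.
Proof.
move=> t0; rewrite /step_idx.
have e1 : 1 <= expR t by rewrite -expR0 ler_expR.
have : (0 < Num.truncn (expR t))%N by rewrite truncn_gt0.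
move=> /prednK ->; apply/andP; split; last exact: truncnS_gt.
by rewrite truncn_le// expR_ge0.
Qed.

Lemma LinvE a t : 0 <= t -> Linv (step_fun a) t = a (step_idx t).
Proof. by move=> t0; rewrite /Linv; apply: step_funE; exact: step_idxP. Qed.

Lemma unit_itv_ge0 (k : nat) (t : R) : `[k%:R, k.+1%:R]%classic t -> 0 <= t.
Proof. by rewrite /= in_itv/= => /andP[kt _]; exact: le_trans kt. Qed.

Lemma mu_unit_itv (k : nat) : mu `[k%:R, k.+1%:R] = 1%E.
Proof.
rewrite lebesgue_measure_itv/= lte_fin ltr_nat ltnSn -EFinB; congr EFin.
by rewrite -natr1; ring.
Qed.

Lemma bounded_integrable (f : R -> R) (k : nat) (K : R) : measurable_fun setT f ->
  (forall t, `[k%:R, k.+1%:R]%classic t -> `|f t| <= K) ->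
  mu.-integrable `[k%:R, k.+1%:R] (EFin \o f).
Proof.
move=> mf fK; apply: measurable_bounded_integrable => //.
- by rewrite [X in (X < _)%E](mu_unit_itv k) ltry.
- exact: measurable_funTS.
- exists K; split; first exact: num_real.
  by move=> M KM x kx; apply: le_trans (ltW KM); exact: fK.
Qed.

Lemma linfty_integrable a k : linfty a ->
  mu.-integrable `[k%:R, k.+1%:R] (EFin \o Linv (step_fun a)).
Proof.
move=> [K aK]; apply: (@bounded_integrable _ _ K); first exact: measurable_step_exp.
by move=> t /unit_itv_ge0 t0; rewrite LinvE.
Qed.

(** By definition [Lmap xi a] is [xi (expavg a)]. *)
Definition expavg a : nat -> R := Emap (Linv (step_fun a)).

Lemma expavg_le a b k : linfty a -> linfty b ->
  (forall t, k%:R <= t <= k.+1%:R -> a (step_idx t) <= b (step_idx t)) ->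
  expavg a k <= expavg b k.
Proof.
move=> la lb ab; apply: le_Rintegral; rewrite //; try exact: linfty_integrable.
move=> t kt; have t0 := unit_itv_ge0 kt; rewrite !LinvE//.
by apply: ab; move: kt; rewrite /= in_itv.
Qed.

Lemma expavg_cst (r : R) k : expavg (fun=> r) k = r.
Proof.
rewrite /expavg /Emap (@eq_Rintegral _ _ _ _ _ (fun=> r)).
  by rewrite Rintegral_cst//= [X in fine X](mu_unit_itv k) mulr1.
by move=> t; rewrite inE => /unit_itv_ge0 t0; rewrite LinvE.
Qed.

Lemma linfty_cst (r : R) : linfty (fun=> r).
Proof. by exists `|r|. Qed.

Lemma linfty_lin (r : R) a b : linfty a -> linfty b -> linfty (fun k => r * a k + b k).
Proof.
move=> [K aK] [L bL]; exists (`|r| * K + L) => k.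
by apply: le_trans (ler_normD _ _) _; rewrite normrM lerD// ler_wpM2l.
Qed.

Lemma expavg_linear (r : R) a b k : linfty a -> linfty b ->
  expavg (fun k => r * a k + b k) k = r * expavg a k + expavg b k.
Proof.
move=> la lb; rewrite /expavg /Emap.
rewrite -RintegralZl//; last exact: linfty_integrable.
rewrite -RintegralD//; [|  | exact: linfty_integrable].
  by apply: eq_Rintegral => t; rewrite inE => /unit_itv_ge0 t0; rewrite !LinvE.
have [K aK] := la; apply: (@bounded_integrable _ _ (`|r| * K)).
  by apply: measurable_funM => //; exact: measurable_step_exp.
by move=> t /unit_itv_ge0 t0; rewrite LinvE// normrM ler_wpM2l.
Qed.

Lemma expavg_bound a (K : R) k : linfty a ->
  (forall t, k%:R <= t <= k.+1%:R -> `|a (step_idx t)| <= K) -> `|expavg a k| <= K.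
Proof.
move=> la aK; rewrite ler_norml -(expavg_cst (- K) k) -{2}(expavg_cst K k).
apply/andP; split; apply: expavg_le => //; try exact: linfty_cst.
  by move=> t kt; have := aK t kt; rewrite ler_norml => /andP[].
by move=> t kt; have := aK t kt; rewrite ler_norml => /andP[].
Qed.

Lemma linfty_expavg a : linfty a -> linfty (expavg a).
Proof. by move=> la; have [K aK] := la; exists K => k; exact: expavg_bound. Qed.

(** Moving [t] by 1 carries one interval of [Emap] to the next: a comparison of terms at [n] and at
    about [e n] becomes a translation of the averages. *)
Lemma expavg_shift a b k : linfty a -> linfty b ->
  (forall t, k%:R <= t <= k.+1%:R -> a (step_idx t) <= b (step_idx (t + 1))) ->
  expavg a k <= expavg b k.+1.
Proof.
move=> la lb ab; have [K bK] := lb.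
have mb1 : measurable_fun setT (fun t : R => Linv (step_fun b) (t + 1)).
  apply: measurableT_comp; first exact: measurable_step_exp.
  by apply: measurable_funD => //; exact: measurable_id.
have int1 : mu.-integrable `[k%:R, k.+1%:R] (EFin \o (fun t => Linv (step_fun b) (t + 1))).
  apply: (@bounded_integrable _ _ K) => // t /unit_itv_ge0 t0.
  by rewrite LinvE// addr_ge0.
have -> : expavg b k.+1 = \int[mu]_(t in `[k%:R, k.+1%:R]) Linv (step_fun b) (t + 1).
  rewrite (@Rintegral_shift _ (Linv (step_fun b)) 1 k%:R k.+1%:R)//; last exact: measurable_step_exp.
  by rewrite /expavg /Emap !natr1.
apply: le_Rintegral => //; first exact: linfty_integrable.
move=> t kt; have t0 := unit_itv_ge0 kt; rewrite !LinvE ?addr_ge0//.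
apply: ab.
by move: kt; rewrite /= in_itv.
Qed.

End sequences.

Section states.
Context {R : realType}.
Implicit Types (a b c : nat -> R) (w xi : (nat -> R) -> R).

Lemma linftyD a b : linfty a -> linfty b -> linfty (fun k => a k + b k).
Proof.
move=> la lb; have -> : (fun k => a k + b k) = (fun k => 1 * a k + b k).
  by apply/funext => k; rewrite mul1r.
exact: linfty_lin.
Qed.

Lemma linftyZ r a : linfty a -> linfty (fun k => r * a k).
Proof.
move=> la; have -> : (fun k => r * a k) = (fun k => r * a k + 0).
  by apply/funext => k; rewrite addr0.
by apply: linfty_lin => //; exact: linfty_cst.
Qed.

Lemma linftyN a : linfty a -> linfty (fun k => - a k).
Proof.
move=> la; have -> : (fun k => - a k) = (fun k => -1 * a k).
  by apply/funext => k; rewrite mulN1r.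
exact: linftyZ.
Qed.

Section state.
Variable w : (nat -> R) -> R.
Hypothesis sw : state w.

Lemma state_lin r a b : linfty a -> linfty b ->
  w (fun k => r * a k + b k) = r * w a + w b.
Proof. by case: sw => h _ _; exact: h. Qed.

Lemma stateD a b : linfty a -> linfty b -> w (fun k => a k + b k) = w a + w b.
Proof.
move=> la lb; rewrite -[w a]mul1r -state_lin//; congr w.
by apply/funext => k; rewrite mul1r.
Qed.

Lemma state0 : w (fun=> 0) = 0.
Proof.
have := stateD (linfty_cst 0) (linfty_cst 0).
rewrite (_ : (fun k : nat => 0 + 0) = (fun=> 0)).
  by move/eqP; rewrite -subr_eq subrr => /eqP.
by apply/funext => k; rewrite addr0.
Qed.

Lemma stateZ r a : linfty a -> w (fun k => r * a k) = r * w a.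
Proof.
move=> la; rewrite -[RHS]addr0 -[X in _ + X]state0 -state_lin//; last exact: linfty_cst.
by congr w; apply/funext => k; rewrite addr0.
Qed.

Lemma stateN a : linfty a -> w (fun k => - a k) = - w a.
Proof.
move=> la; rewrite -mulN1r -stateZ//; congr w.
by apply/funext => k; rewrite mulN1r.
Qed.

Lemma state_cst r : w (fun=> r) = r.
Proof.
have [_ _ w1] := sw; rewrite -[RHS]mulr1 -[X in r * X]w1 -stateZ; last exact: linfty_cst.
by congr w; apply/funext => k; rewrite mulr1.
Qed.

Lemma state_le a b : linfty a -> linfty b -> (forall k, a k <= b k) -> w a <= w b.
Proof.
move=> la lb ab; rewrite -subr_ge0 -stateN// -stateD//; last exact: linftyN.
by have [_ h _] := sw; apply: h => [|k]; [exact/linftyD/linftyN|rewrite subr_ge0].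
Qed.

End state.

Lemma Lmap_state xi : state xi -> state (Lmap xi).
Proof.
move=> sxi; split.
- move=> r a b la lb; rewrite /Lmap -/(expavg _) -/(expavg a) -/(expavg b).
  rewrite -state_lin//; try exact: linfty_expavg.
  by congr xi; apply/funext => k; exact: expavg_linear.
- move=> a la a0; rewrite /Lmap -/(expavg _).
  have [_ h _] := sxi; apply: h => [|k]; first exact: linfty_expavg.
  by rewrite -(expavg_cst 0 k); apply: expavg_le => //; exact: linfty_cst.
- have [_ _ {2}<-] := sxi; rewrite /Lmap -/(expavg _); congr xi.
  by apply/funext => k; exact: expavg_cst.
Qed.

Lemma linfty_translate n a : linfty a -> linfty (translate n a).
Proof. by move=> [K aK]; exists K => k; exact: aK. Qed.

Lemma BL_translate xi n a : BL xi -> linfty a -> xi (translate n a) = xi a.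
Proof.
case=> _ h la; case: n => [|n]; last exact: h.
by congr xi; apply/funext => k; rewrite /translate addn0.
Qed.

Lemma BL_shift_le xi a b n : BL xi -> linfty a -> linfty b ->
  (forall k, a k <= b (k + n)%N) -> xi a <= xi b.
Proof.
move=> BLxi la lb ab; rewrite -(BL_translate n BLxi lb).
have [sxi _] := BLxi.
by apply: (state_le sxi) => //; exact: linfty_translate.
Qed.

(** From [1 + t <= e^t]; it guarantees that late averages see only late terms. *)
Lemma step_idx_ge (k : nat) (t : R) : k%:R <= t -> (k <= step_idx t)%N.
Proof.
move=> kt; have t0 : 0 <= t by exact: le_trans kt.
have /andP[_ h] := step_idxP t0.
have : k.+1%:R < (step_idx t).+2%:R :> R.
  apply: le_lt_trans h; rewrite -natr1 addrC.
  by apply: le_trans (expR_ge1Dx _); rewrite lerD2l.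
by rewrite ltr_nat !ltnS.
Qed.

(** [1 - 1/2 <= e^(-1/2)] gives [e^(1/2) <= 2]. A crude bound is enough: it only enters the factor 4
    of [Lmap_dilation_le]. *)
Lemma expR1_le4 : expR 1 <= 4 :> R.
Proof.
have h : expR (1 / 2) <= 2 :> R.
  have := @expR_ge1Dx R (- (1 / 2)); rewrite expRN => e.
  rewrite -[leLHS]invrK -[leRHS]invrK lef_pV2 ?posrE ?invr_gt0 ?expR_gt0//.
  by apply: le_trans e; lra.
have -> : expR 1 = expR (1 / 2) * expR (1 / 2) :> R.
  by rewrite -expRD; congr expR; lra.
by have := expR_ge0 (1 / 2 : R); nra.
Qed.

Lemma Lmap_dilation_le xi a b c : BL xi -> linfty a -> linfty b ->
  c @ \oo --> (0 : R) ->
  (forall n m, (2 * n.+1 <= m.+1)%N -> (m.+1 <= 4 * n.+2)%N -> a n <= b m + c n) ->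
  Lmap xi a <= Lmap xi b.
Proof.
move=> BLxi la lb c0 abc; have [sxi _] := BLxi.
apply/ler_addgt0Pr => e e0.
have [N _ cN] : \forall n \near \oo, `|c n| < e.
  by move/cvgrPdist_lt : c0 => /(_ e e0); apply: filterS => n; rewrite sub0r normrN.
rewrite /Lmap -/(expavg a) -/(expavg b).
rewrite -[X in _ + X](state_cst sxi) -(stateD sxi); [|exact: linfty_expavg|exact: linfty_cst].
rewrite -(BL_translate N BLxi (linfty_expavg la)).
apply: (@BL_shift_le _ _ _ N.+1) => //.
- exact/linfty_translate/linfty_expavg.
- by apply: linftyD; [exact: linfty_expavg|exact: linfty_cst].
move=> k; rewrite /translate addnS.
rewrite -(expavg_cst e (k + N).+1).
have -> : expavg b (k + N).+1 + expavg (fun=> e) (k + N).+1 =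
    expavg (fun k => 1 * b k + e) (k + N).+1.
  by rewrite expavg_linear ?mul1r//; exact: linfty_cst.
apply: expavg_shift => //; first by apply: linfty_lin => //; exact: linfty_cst.
move=> t /andP[kt _]; rewrite mul1r.
have t0 : 0 <= t by exact: le_trans kt.
have nN : (N <= step_idx t)%N.
  by apply: step_idx_ge; apply: le_trans kt; rewrite ler_nat leq_addl.
have t1 : 0 <= t + 1 by rewrite addr_ge0.
have /andP[n1 n2] := step_idxP t0; have /andP[m1 m2] := step_idxP t1.
have cn := cN _ nN.
(* [2 (n + 1) <= 2 e^t <= e^(t + 1) < m + 2], a strict inequality between integers. *)
have le1 : (2 * (step_idx t).+1 <= (step_idx (t + 1)).+1)%N.
  rewrite -ltnS -(@ltr_nat R); apply: le_lt_trans m2.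
  rewrite natrM expRD mulrC; apply: ler_pM => //.
  by apply: le_trans (expR_ge1Dx _).
have le2 : ((step_idx (t + 1)).+1 <= 4 * (step_idx t).+2)%N.
  rewrite -(@ler_nat R); apply: le_trans m1 _.
  rewrite natrM expRD mulrC; apply: ler_pM; rewrite ?expR_ge0 ?expR1_le4//.
  exact: ltW.
apply: le_trans (abc _ _ le1 le2) _; rewrite lerD2l.
by apply: le_trans (ler_norm _) _; exact: ltW.
Qed.

End states.

(** * Dixmier traces *)

Lemma add_sub_parallelogram (V : zmodType) (p q r t : V) :
  p + q + (r + t) + (p - q - (r - t)) = p + p + (t + t).
Proof.
rewrite opprB addrACA [p + q + _]addrACA subrr addr0.
by rewrite [r + t]addrC [t + r + _]addrACA subrr addr0.
Qed.

Lemma parallelogram_sub (R : realType) (t1 t2 t3 t4 p1 p2 p3 p4 : R) :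
  t1 + t2 = 2 * t3 + 2 * t4 -> p1 + p2 = 2 * p3 + 2 * p4 ->
  t1 - p1 + (t2 - p2) = 2 * (t3 - p3) + 2 * (t4 - p4).
Proof. lra. Qed.

Lemma double_sum (R : realType) (t u a b c d : R) :
  t = u -> u = a + b -> a = c + c -> b = d + d -> t = 2 * c + 2 * d.
Proof. lra. Qed.

Lemma affine_seq (R : realType) (g : nat -> R) :
  (forall n, g n.+2 + g n = 2 * g n.+1) ->
  forall n, g n = g 0%N + n%:R * (g 1%N - g 0%N).
Proof.
move=> rec n.
suff [] : g n = g 0%N + n%:R * (g 1%N - g 0%N) /\
    g n.+1 = g 0%N + n.+1%:R * (g 1%N - g 0%N) by [].
elim: n => [|n [IH1 IH2]]; first by rewrite mul0r addr0 mul1r addrC subrK.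
split => //; have := rec n; rewrite IH1 IH2 => /(canRL (addrK _)) ->.
by rewrite -[n.+2%:R]natr1 -[n.+1%:R]natr1; ring.
Qed.

Section trace.
Context {R : realType} {H : completeNormedModType R[i]}.
Variable ip : {dot H for Num.conj}.
Hypothesis hn : hilbert_norm ip.
Hypothesis infH : inf_dim ip.
Implicit Types (a : R[i]) (x y z : H) (e u v : nat -> H) (s : nat -> R) (A B S T X : H -> H).
Local Notation rip := (re_ip ip).
Local Notation perp := (perp ip).
Local Notation gamma := (gamma ip).
Local Notation posL1 := (positive_L1infty ip).
Local Notation "''N' a" := (normc a ^+ 2) (at level 10, a at level 8).

Lemma ln_gt0S (k : nat) : 0 < ln k.+2%:R :> R.
Proof. by rewrite ln_gt0// ltr1n. Qed.

Lemma inv_ln_cvg0 : (fun k : nat => (ln k.+2%:R)^-1 : R) @ \oo --> (0 : R).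
Proof.
apply/cvgrPdist_lt => e e0.
have [N hN] : exists N : nat, expR e^-1 < N%:R by exists (Num.truncn (expR e^-1)).+1; exact: truncnS_gt.
exists N => // k /= Nk; rewrite sub0r normrN ger0_norm ?invr_ge0 ?(ltW (ln_gt0S k))//.
rewrite invf_plt ?posrE ?ln_gt0S//.
rewrite -[ltLHS]expRK ltr_ln ?posrE ?expR_gt0//.
by apply: lt_le_trans hN _; rewrite ler_nat (leq_trans Nk)// -addn2 leq_addr.
Qed.

Lemma gammaE S k : gamma S k = (ln k.+2%:R)^-1 * ksum ip S k.+1.
Proof. by []. Qed.

#[local] Opaque Lmap Defs.gamma.

Lemma ksum_ge0 S n : positive_op ip S -> compact_op S -> 0 <= ksum ip S n.
Proof. by move=> pS cS; apply: sumr_ge0 => i _; exact: mu_ge0. Qed.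

Lemma gamma_ge0 S k : positive_op ip S -> compact_op S -> 0 <= gamma S k.
Proof.
by move=> pS cS; rewrite gammaE mulr_ge0 ?invr_ge0 ?(ltW (ln_gt0S k)) ?ksum_ge0.
Qed.

Lemma gamma_linfty S : posL1 S -> linfty (gamma S).
Proof.
by move=> [pS [cS [K gK]]]; exists K => k; rewrite ger0_norm ?gamma_ge0.
Qed.

Lemma posL1D S T : posL1 S -> posL1 T -> posL1 (S + T).
Proof.
move=> [pS [cS [K gK]]] [pT [cT [L gL]]]; split; first exact: pos_opD.
split; first exact: compact_opD.
exists (K + L) => k; apply: le_trans (lerD (gK k) (gL k)).
rewrite !gammaE -mulrDr ler_wpM2l ?invr_ge0 ?(ltW (ln_gt0S k))//.
exact: ksumD_le.
Qed.

Lemma posL1_conj X X' T : bounded_op X -> is_adjoint ip X X' -> posL1 T ->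
  posL1 (X \o T \o X').
Proof.
move=> bX XX' [pT [cT [K gK]]]; split; first exact: pos_op_conj.
split; first by apply: compact_op_conj => //; exact: adj_bounded XX'.
have [lX [c c0 cX]] := (bounded_opP X).1 bX.
exists (c ^+ 2 * K) => k; rewrite gammaE.
apply: (@le_trans _ _ (c ^+ 2 * gamma T k)); last by rewrite ler_wpM2l ?sqr_ge0.
rewrite gammaE mulrCA ler_wpM2l ?invr_ge0 ?(ltW (ln_gt0S k))//.
exact: ksum_conj_le.
Qed.

Section functional.
Variable xi : (nat -> R) -> R.
Hypothesis BLxi : BL xi.
Local Notation w := (Lmap xi).

Let sw : state w. Proof. by apply: Lmap_state; case: BLxi. Qed.

Definition tau S := w (gamma S).

(** Subadditivity holds term by term. Conversely the doubled index [2 (n + 1)] is at most [m + 1],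
    and [ln (m + 2)] exceeds [ln (n + 2)] by a bounded amount only, which disappears in the limit
    after division by [ln (n + 2)]. *)
Lemma tauD S T : posL1 S -> posL1 T -> tau (S + T) = tau S + tau T.
Proof.
move=> lS lT; have lST := posL1D lS lT.
have [[gS gT] gST] := (gamma_linfty lS, gamma_linfty lT, gamma_linfty lST).
have [pS [cS _]] := lS; have [pT [cT _]] := lT; have [pST [cST [K gK]]] := lST.
rewrite /tau -(stateD sw gS gT); apply/eqP; rewrite eq_le; apply/andP; split.
  apply: (state_le sw) => //; first exact: linftyD.
  move=> k; rewrite !gammaE -mulrDr ler_wpM2l ?invr_ge0 ?(ltW (ln_gt0S k))//.
  exact: ksumD_le.
(* The 8 comes from [m + 2 <= 4 (n + 2) + 1 <= 8 (n + 2)], and [|K|] bounds [gamma (S + T)]. *)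
pose c (n : nat) := `|K| * ln 8 * (ln n.+2%:R)^-1 : R.
apply: (@Lmap_dilation_le _ _ _ _ c) => //; first exact: linftyD.
  rewrite -[X in _ --> X](mulr0 (`|K| * ln 8)).
  by apply: cvgM; [exact: cvg_cst|exact: inv_ln_cvg0].
move=> n m h1 h2; rewrite (gammaE S) (gammaE T) -mulrDr.
have l0 := ln_gt0S n; have l0' := ln_gt0S m.
rewrite ler_pdivrMl//.
apply: le_trans (ksumD_ge hn infH _ pS cS pT cT) _.
apply: le_trans (ksum_mono hn infH pST cST h1) _.
rewrite /c mulrDr mulrC [ln n.+2%:R * (_ * _ / _)]mulrCA mulfV ?gt_eqF// mulr1.
have -> : ksum ip (S + T) m.+1 = ln m.+2%:R * gamma (S + T) m.
  by rewrite gammaE mulVKf// gt_eqF.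
have lnle : ln m.+2%:R <= ln 8 + ln n.+2%:R :> R.
  rewrite -lnM ?posrE// ler_ln ?posrE ?mulr_gt0// -natrM ler_nat.
  by lia.
have gm := gamma_ge0 m pST cST.
have gmK : gamma (S + T) m <= `|K| by apply: le_trans (gK m) (ler_norm _).
have l8 : 0 <= ln 8 :> R by rewrite ln_ge0// ler1n.
nra.
Qed.

Section fixed_operator.
Variables (T : H -> H) (v : nat -> H) (s : nat -> R).
Hypotheses (lT : posL1 T) (gT : greedy ip T v s).

Let pT : positive_op ip T. Proof. by case: lT. Qed.
Let cT : compact_op T. Proof. by case: lT => _ []. Qed.

Definition wavg (f : nat -> R) k := (ln k.+2%:R)^-1 * \sum_(j < k.+1) s j * f j.

Lemma gamma_wavg : gamma T = wavg (fun=> 1).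
Proof.
apply/funext => k; rewrite gammaE /wavg (ksum_greedy hn _ pT gT); congr (_ * _).
by apply: eq_bigr => j _; rewrite mulr1.
Qed.

Lemma wavg_le f g k : (forall j, f j <= g j) -> wavg f k <= wavg g k.
Proof.
move=> fg; rewrite /wavg ler_wpM2l ?invr_ge0 ?(ltW (ln_gt0S k))//.
apply: ler_sum => j _; rewrite ler_wpM2l//; by have [_ _ h _] := gT.
Qed.

Lemma wavg_lin (c : R) f g k : wavg (fun j => c * f j + g j) k = c * wavg f k + wavg g k.
Proof.
rewrite /wavg mulrCA -mulrDr; congr (_ * _); rewrite mulr_sumr -big_split /=.
by apply: eq_bigr => j _; ring.
Qed.

Lemma wavg_linfty f : linfty f -> linfty (wavg f).
Proof.
move=> [K fK]; have [L hL] := gamma_linfty lT; exists (K * L) => k.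
have K0 : 0 <= K by apply: le_trans (fK 0%N).
have wc (c : R) : wavg (fun=> c) k = c * gamma T k.
  rewrite gamma_wavg /wavg mulrCA; congr (_ * _); rewrite mulr_sumr.
  by apply: eq_bigr => j _; ring.
apply: (@le_trans _ _ (K * gamma T k)); last first.
  by rewrite ler_wpM2l//; apply: le_trans (ler_norm _) (hL k).
rewrite ler_norml -mulNr -!wc; apply/andP; split; apply: wavg_le => j.
  by have := fK j; rewrite ler_norml => /andP[].
by apply: le_trans (ler_norm _) (fK j).
Qed.

(** A functional of bounded real sequences; the [psi A] of the overview is its value at the diagonal
    [<A v_j, v_j>], taken on real and imaginary parts separately. *)
Definition psi f := w (wavg f).

Lemma psi_lin (c : R) f g : linfty f -> linfty g ->
  psi (fun j => c * f j + g j) = c * psi f + psi g.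
Proof.
move=> lf lg; rewrite /psi -(state_lin sw); try exact: wavg_linfty.
by congr (Lmap xi); apply/funext => k; exact: wavg_lin.
Qed.

Lemma psiD f g : linfty f -> linfty g -> psi (fun j => f j + g j) = psi f + psi g.
Proof.
move=> lf lg; have := psi_lin 1 lf lg; rewrite mul1r => <-; congr psi.
by apply/funext => k; rewrite mul1r.
Qed.

Lemma psiZ c f : linfty f -> psi (fun j => c * f j) = c * psi f.
Proof.
move=> lf; have l0 := @linfty_cst R 0.
have p0 : psi (fun=> 0) = 0.
  have := psiD l0 l0; rewrite (_ : (fun j : nat => 0 + 0) = (fun=> 0)).
    by move/eqP; rewrite -subr_eq subrr => /eqP.
  by apply/funext => j; rewrite addr0.
have := psi_lin c lf l0; rewrite p0 addr0 => <-; congr psi.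
by apply/funext => j; rewrite addr0.
Qed.

Lemma psi_le f g : linfty f -> linfty g -> (forall j, f j <= g j) -> psi f <= psi g.
Proof.
move=> lf lg fg; apply: (state_le sw); try exact: wavg_linfty.
by move=> k; exact: wavg_le.
Qed.

Lemma psi1 : psi (fun=> 1) = tau T.
Proof. by rewrite /tau gamma_wavg. Qed.

Lemma psi_bound f K : (forall j, `|f j| <= K) -> `|psi f| <= K * tau T.
Proof.
move=> fK; have lf : linfty f by exists K.
have l1 := @linfty_cst R 1.
have pc c : c * tau T = psi (fun=> c).
  by rewrite -psi1 -(psiZ c l1); congr psi; apply/funext => j; rewrite mulr1.
rewrite ler_norml -mulNr !pc; apply/andP; split; apply: psi_le => //; try exact: linfty_cst.
  by move=> j; have := fK j; rewrite ler_norml => /andP[].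
by move=> j; have := fK j; rewrite ler_norml => /andP[].
Qed.

(** The diagonal of [X^* X] in the vectors [v]. *)
Definition sqn X (j : nat) : R := nrm (X (v j)) ^+ 2.

Lemma sqn_linfty X : bounded_op X -> linfty (sqn X).
Proof.
move=> /bounded_opP[_ [c c0 cX]]; exists (c ^+ 2) => j; rewrite ger0_norm ?sqr_ge0//.
rewrite /sqn ler_sqr ?nnegrE ?nrm_ge0//; apply: le_trans (cX _) _.
by rewrite (greedy_unit hn gT) mulr1.
Qed.

(* By Ky Fan the defect is nonnegative; it is a quadratic form in [X] that
   vanishes on scalars, hence is invariant under adding scalars to [X]. *)
Definition defect X X' := tau (X \o T \o X') - psi (sqn X).

Lemma defect_ge0 X X' : bounded_op X -> is_adjoint ip X X' -> 0 <= defect X X'.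
Proof.
move=> bX XX'; rewrite subr_ge0; apply: (state_le sw).
- exact/wavg_linfty/sqn_linfty.
- exact/gamma_linfty/posL1_conj.
move=> k; rewrite gammaE ler_wpM2l ?invr_ge0 ?(ltW (ln_gt0S k))//.
exact: (ksum_conj_ge hn infH _ pT cT gT).
Qed.

Lemma adj_lin a X X' Y Y' : is_adjoint ip X X' -> is_adjoint ip Y Y' ->
  is_adjoint ip (a *: X + Y) ((a^*)%C *: X' + Y').
Proof.
by move=> XX' YY' x y; rewrite !fctE ipDl ipZl ipDr ipZr conjcK XX' YY'.
Qed.

(** Comes from the parallelogram law for [X |-> X T X^*]. The factors 2 of [tau] are obtained as
    sums of two equal operators, so that additivity is enough. *)
Lemma defect_parallelogram X X' Y Y' : bounded_op X -> is_adjoint ip X X' ->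
  bounded_op Y -> is_adjoint ip Y Y' ->
  defect (X + Y) (X' + Y') + defect (X - Y) (X' - Y') =
  2 * defect X X' + 2 * defect Y Y'.
Proof.
move=> bX XX' bY YY'.
have bp : bounded_op (X + Y) by have := bounded_op_lin 1 bX bY; rewrite scale1r.
have bm : bounded_op (X - Y) by have := bounded_op_lin (-1) bY bX; rewrite scaleN1r addrC.
have ap : is_adjoint ip (X + Y) (X' + Y').
  by have := adj_lin 1 XX' YY'; rewrite conjc1 !scale1r.
have am : is_adjoint ip (X - Y) (X' - Y').
  have := adj_lin (-1) YY' XX'.
  have -> : ((-1 : R[i])^*)%C = -1 by apply: complex_ext; rewrite /= ?oppr0.
  by rewrite !scaleN1r [- Y + X]addrC [- Y' + X']addrC.
have lT' := bounded_lin pT.1; have lX := bounded_lin bX; have lY := bounded_lin bY.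
have opE : ((X + Y) \o T \o (X' + Y')) + ((X - Y) \o T \o (X' - Y')) =
   ((X \o T \o X') + (X \o T \o X')) + ((Y \o T \o Y') + (Y \o T \o Y')).
  apply/funext => x; rewrite !fctE /= (linD _ _ lT') (linB _ _ lT').
  rewrite !(linB _ _ lX) !(linB _ _ lY) !(linD _ _ lX) !(linD _ _ lY).
  exact: add_sub_parallelogram.
have tE : tau ((X + Y) \o T \o (X' + Y')) + tau ((X - Y) \o T \o (X' - Y')) =
   2 * tau (X \o T \o X') + 2 * tau (Y \o T \o Y').
  have lx := posL1_conj bX XX' lT; have ly := posL1_conj bY YY' lT.
  have lp := posL1_conj bp ap lT; have lm := posL1_conj bm am lT.
  apply: (double_sum (esym (tauD lp lm)) _ (tauD lx lx) (tauD ly ly)).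
  by rewrite opE (tauD (posL1D lx lx) (posL1D ly ly)).
have pE : psi (sqn (X + Y)) + psi (sqn (X - Y)) = 2 * psi (sqn X) + 2 * psi (sqn Y).
  rewrite -psiD; try exact: sqn_linfty.
  rewrite -(psiZ 2 (sqn_linfty bY)).
  rewrite -(psi_lin 2 (sqn_linfty bX) (linftyZ 2 (sqn_linfty bY))).
  congr psi; apply/funext => j; rewrite /sqn !fctE -!(ripxx hn).
  by rewrite !(ripDl, ripDr, ripNl, ripNr); ring.
exact: parallelogram_sub tE pE.
Qed.

Definition scal_op a : H -> H := fun x => a *: x.

Lemma bounded_scal_op a : bounded_op (scal_op a).
Proof.
apply/bounded_opP; split; first by move=> b x y; rewrite /scal_op scalerDr !scalerA mulrC.
by exists (normc a) => [|x]; rewrite ?normc_ge0// nrmZ.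
Qed.

Lemma adj_scal_op a : is_adjoint ip (scal_op a) (scal_op (a^*)%C).
Proof. by move=> x y; rewrite ipZl ipZr conjcK. Qed.

Lemma scal_opN a : scal_op (- a) = - scal_op a.
Proof. by apply/funext => x; rewrite /scal_op scaleNr. Qed.

Lemma scal_opD a b : scal_op (a + b) = scal_op a + scal_op b.
Proof. by apply/funext => x; rewrite /scal_op scalerDl. Qed.

(** For [|a| = 1/2] four copies of [a T a^*] add up to [T], so additivity alone evaluates [tau];
    hence this modulus from here on. *)
Lemma defect_scal_op a : normc a = 2^-1 -> defect (scal_op a) (scal_op (a^*)%C) = 0.
Proof.
move=> na; rewrite /defect; set Q := _ \o _ \o _.
have lQ : posL1 Q := posL1_conj (bounded_scal_op a) (adj_scal_op a) lT.
have QE : (Q + Q) + (Q + Q) = T.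
  apply/funext => x; rewrite !fctE /Q /= /scal_op (linZ _ _ (bounded_lin pT.1)) scalerA.
  rewrite normc_sqrE na -!scalerDl -!rmorphD/= (_ : _ + _ = 1) ?scale1r//.
  by field.
have -> : psi (sqn (scal_op a)) = (2^-1) ^+ 2 * tau T.
  rewrite -psi1 -(psiZ _ (linfty_cst 1)); congr psi; apply/funext => j.
  by rewrite mulr1 /sqn nrmZ na (greedy_unit hn gT) mulr1.
have := tauD (posL1D lQ lQ) (posL1D lQ lQ); rewrite QE (tauD lQ lQ).
by move: (tau Q) (tau T) => q t ->; field.
Qed.

Lemma defectE X X' : defect X X' = tau (X \o T \o X') - psi (sqn X).
Proof. by []. Qed.

#[local] Opaque tau psi defect.

Lemma affine_ge0_slope (a d : R) : (forall n : nat, 0 <= a + n%:R * d) -> 0 <= d.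
Proof.
move=> h; rewrite leNgt; apply/negP => d0.
pose n := (Num.truncn (`|a| / - d)).+1.
have nd : 0 < - d by rewrite oppr_gt0.
have : `|a| / - d < n%:R by exact: truncnS_gt.
rewrite ltr_pdivrMr// mulrN => h1; have := h n; rewrite leNgt => /negP; apply.
by have := ler_norm a; lra.
Qed.

(** Along [X + n a] the parallelogram law, with defect 0 at [a], kills the second differences: the
    defect is affine in [n] and nonnegative, so its slope cannot be negative. *)
Lemma defect_shift_ge X X' a : bounded_op X -> is_adjoint ip X X' -> normc a = 2^-1 ->
  defect X X' <= defect (X + scal_op a) (X' + scal_op (a^*)%C).
Proof.
move=> bX XX' na.
pose Y n := X + scal_op (n%:R * a); pose Y' n := X' + scal_op ((n%:R * a)^*)%C.
have bY n : bounded_op (Y n).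
  by have := bounded_op_lin 1 bX (bounded_scal_op (n%:R * a)); rewrite scale1r.
have aY n : is_adjoint ip (Y n) (Y' n).
  have := adj_lin 1 XX' (adj_scal_op (n%:R * a)).
  by rewrite (_ : (1^*)%C = 1 :> R[i]) ?scale1r// conjc1.
have Yp n : Y n.+1 + scal_op a = Y n.+2.
  by rewrite /Y -addrA -scal_opD; congr (_ + scal_op _); rewrite -[n.+2%:R]natr1 mulrDl mul1r.
have Ym n : Y n.+1 - scal_op a = Y n.
  by rewrite /Y -addrA -scal_opN -scal_opD; congr (_ + scal_op _); rewrite -[n.+1%:R]natr1 mulrDl mul1r addrK.
have Y'p n : Y' n.+1 + scal_op (a^*)%C = Y' n.+2.
  rewrite /Y' -addrA -scal_opD; congr (_ + scal_op _).
  by rewrite -rmorphD; congr (_^*)%C; rewrite -[n.+2%:R]natr1 mulrDl mul1r.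
have Y'm n : Y' n.+1 - scal_op (a^*)%C = Y' n.
  rewrite /Y' -addrA -scal_opN -scal_opD; congr (_ + scal_op _).
  by rewrite -rmorphN -rmorphD; congr (_^*)%C; rewrite -[n.+1%:R]natr1 mulrDl mul1r addrK.
have Y0 : Y 0%N = X.
  by apply/funext => x; rewrite /Y fctE /scal_op mul0r scale0r addr0.
have Y'0 : Y' 0%N = X'.
  by apply/funext => x; rewrite /Y' fctE /scal_op mul0r conjc0 scale0r addr0.
have Y1 : Y 1%N = X + scal_op a by rewrite /Y mul1r.
have Y'1 : Y' 1%N = X' + scal_op (a^*)%C by rewrite /Y' mul1r.
clearbody Y Y'; pose g n := defect (Y n) (Y' n).
have rec n : g n.+2 + g n = 2 * g n.+1.
  have := defect_parallelogram (bY n.+1) (aY n.+1) (bounded_scal_op a) (adj_scal_op a).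
  by rewrite Yp Ym Y'p Y'm (defect_scal_op na) mulr0 addr0.
have : 0 <= g 1%N - g 0%N.
  apply: (@affine_ge0_slope (g 0%N)) => n; rewrite -(affine_seq rec n).
  exact: defect_ge0.
by rewrite subr_ge0 /g Y0 Y'0 Y1 Y'1.
Qed.

(** Neither the shift by [a] nor that by [- a] lowers the defect, and by the parallelogram law their
    mean is the original value. *)
Lemma defect_shift X X' a : bounded_op X -> is_adjoint ip X X' -> normc a = 2^-1 ->
  defect (X + scal_op a) (X' + scal_op (a^*)%C) = defect X X' /\
  defect (X - scal_op a) (X' - scal_op (a^*)%C) = defect X X'.
Proof.
move=> bX XX' na.
have h1 := defect_shift_ge bX XX' na.
have nN : normc (- a) = 2^-1 by rewrite normcN.
have := defect_shift_ge bX XX' nN; rewrite rmorphN !scal_opN => h2.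
have := defect_parallelogram bX XX' (bounded_scal_op a) (adj_scal_op a).
rewrite (defect_scal_op na) mulr0 addr0; move: h1 h2.
move: (defect X X') (defect (X + _) _) (defect (X - _) _) => d0 d1 d2.
by move=> ? ? ?; split; lra.
Qed.

(** The two defects agree, so the difference of the [tau] equals that of the [psi], where
    polarization is done on vectors. *)
Lemma tau_polarize X X' a : bounded_op X -> is_adjoint ip X X' -> normc a = 2^-1 ->
  tau ((X + scal_op a) \o T \o (X' + scal_op (a^*)%C)) -
  tau ((X - scal_op a) \o T \o (X' - scal_op (a^*)%C)) =
  psi (fun j => 4 * rip (X (v j)) (a *: v j)).
Proof.
move=> bX XX' na; have [] := defect_shift bX XX' na; rewrite !defectE => e1 e2.
have bp : bounded_op (X + scal_op a).
  by have := bounded_op_lin 1 bX (bounded_scal_op a); rewrite scale1r.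
have bm : bounded_op (X - scal_op a).
  by have := bounded_op_lin 1 bX (bounded_scal_op (- a)); rewrite scale1r scal_opN.
have lm : linfty (fun j => -1 * sqn (X - scal_op a) j) by apply: linftyZ; exact: sqn_linfty.
have <- : psi (sqn (X + scal_op a)) - psi (sqn (X - scal_op a)) =
    psi (fun j => 4 * rip (X (v j)) (a *: v j)).
  rewrite -[- psi _]mulN1r -(psiZ (-1) (sqn_linfty bm)) -(psiD (sqn_linfty bp) lm).
  congr psi; apply/funext => j; rewrite /sqn !fctE -!(ripxx hn).
  rewrite !(ripDl, ripDr, ripNl, ripNr) [rip (scal_op a _) (X _)]ripC.
  by rewrite -/(scal_op a (v j)); ring.
move: e1 e2.
move: (tau _) (tau _) (tau _) (psi _) (psi _) (psi _) => t1 t2 t3 p1 p2 p3; lra.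
Qed.

End fixed_operator.
End functional.
End trace.

(** * Independence of [Tr] from the decomposition, and the formula for [Tr_w (A T)] *)

Lemma sub_parallelogram (V : zmodType) (p q r t : V) :
  p + q + (r + t) - (p - q - (r - t)) = (q + r) *+ 2.
Proof.
rewrite !opprD !opprK addrACA [p + q + _]addrACA subrr add0r.
by rewrite [r + t + _]addrACA subrr addr0 mulr2n addrACA.
Qed.

Section trace_formula.
Context {R : realType} {H : completeNormedModType R[i]}.
Variable ip : {dot H for Num.conj}.
Hypothesis hn : hilbert_norm ip.
Hypothesis infH : inf_dim ip.
Implicit Types (a : R[i]) (x y z : H) (A B S T X : H -> H).
Local Notation rip := (re_ip ip).
Local Notation posL1 := (positive_L1infty ip).
Variable xi : (nat -> R) -> R.
Hypothesis BLxi : BL xi.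
Local Notation w := (Lmap xi).
Local Notation tau := (tau ip xi).

#[local] Opaque Lmap Defs.gamma.

Lemma ip_decomp T1 T2 T3 T4 x : posL1 T1 -> posL1 T2 -> posL1 T3 -> posL1 T4 ->
  ip ((T1 - T2 + ('i : R[i]) *: (T3 - T4)) x) x =
  (rip (T1 x) x - rip (T2 x) x) +i* (rip (T3 x) x - rip (T4 x) x).
Proof.
move=> [p1 _] [p2 _] [p3 _] [p4 _].
rewrite !fctE ipDl ipZl !ipDl !ipNl !pos_ripE//.
by apply: complex_ext; rewrite !(ReD, ImD, ReM, ImM, ReN, ImN) /=; ring.
Qed.

Lemma tau_sub_eq T1 T2 S1 S2 : posL1 T1 -> posL1 T2 -> posL1 S1 -> posL1 S2 ->
  (forall x, rip (T1 x) x - rip (T2 x) x = rip (S1 x) x - rip (S2 x) x) ->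
  tau T1 - tau T2 = tau S1 - tau S2.
Proof.
move=> t1 t2 s1 s2 h.
have : T1 + S2 = S1 + T2.
  apply: (op_diag_eq hn).
  - exact: (bounded_lin (posL1D hn infH t1 s2).1.1).
  - exact: (bounded_lin (posL1D hn infH s1 t2).1.1).
  move=> x; rewrite !fctE !ipDl !pos_ripE; [|exact: t2.1|exact: s1.1|exact: s2.1|exact: t1.1].
  by rewrite -!rmorphD/=; congr (_%:C); have := h x; lra.
move/(congr1 tau); rewrite (tauD hn infH BLxi t1 s2) (tauD hn infH BLxi s1 t2).
by move: (tau T1) (tau T2) (tau S1) (tau S2) => *; lra.
Qed.

(** [Tr] picks some decomposition of [S]. The diagonals of two decompositions have the same real and
    imaginary parts, and additivity of [tau] does the rest, so any decomposition at hand gives the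
    value. *)
Lemma Tr_eq S T1 T2 T3 T4 : posL1 T1 -> posL1 T2 -> posL1 T3 -> posL1 T4 ->
  S = T1 - T2 + ('i : R[i]) *: (T3 - T4) ->
  Tr ip w S = (tau T1 - tau T2) +i* (tau T3 - tau T4).
Proof.
move=> t1 t2 t3 t4 ES; rewrite /Tr.
set P := (X in xget _ X).
have PT : P ((tau T1 - tau T2) +i* (tau T3 - tau T4)) by exists T1, T2, T3, T4.
have [S1 [S2 [S3 [S4 [[s1 s2 s3 s4] ES' ->]]]]] := xgetPex 0 (ex_intro P _ PT).
have h x : (rip (S1 x) x - rip (S2 x) x) +i* (rip (S3 x) x - rip (S4 x) x) =
    (rip (T1 x) x - rip (T2 x) x) +i* (rip (T3 x) x - rip (T4 x) x).
  by rewrite -(ip_decomp x s1 s2 s3 s4) -(ip_decomp x t1 t2 t3 t4) -ES -ES'.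
have e1 : tau S1 - tau S2 = tau T1 - tau T2.
  by apply: (tau_sub_eq s1 s2 t1 t2) => x; exact: (congr1 (@complex.Re R) (h x)).
have e2 : tau S3 - tau S4 = tau T3 - tau T4.
  by apply: (tau_sub_eq s3 s4 t3 t4) => x; exact: (congr1 (@complex.Im R) (h x)).
exact: (f_equal2 (@Complex R) e1 e2).
Qed.

Section fixed_operator.
Variables (T : H -> H) (v : nat -> H) (s : nat -> R).
Hypotheses (lT : posL1 T) (gT : greedy ip T v s).
Local Notation psi := (psi xi s).

(** With [B = A / 2] and [c'] the conjugate of [c], [(B + c) T (B' + c') - (B - c) T (B' - c')]
    equals [2 (c' B T + c T B')]. Adding [i] times the case [c = i/2] to the case [c = 1/2] cancels
    [T B'] and leaves [A T]. *)
Lemma Tr_formula A A' : bounded_op A -> is_adjoint ip A A' ->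
  Tr ip w (A \o T) = psi (fun j => Re (ip (A (v j)) (v j))) +i*
                     psi (fun j => Im (ip (A (v j)) (v j))).
Proof.
move=> bA AA'.
pose c0 : R[i] := (2^-1)%:C; pose c1 : R[i] := 'i * c0.
pose B := c0 *: A; pose B' := (c0^*)%C *: A'.
have bB : bounded_op B by have := bounded_op_lin c0 bA (@bounded_op0 _ _); rewrite addr0.
have BB' : is_adjoint ip B B' by move=> x y; rewrite [B x]/(c0 *: A x) [B' y]/(_ *: A' y) ipZl ipZr conjcK AA'.
have n0 : normc c0 = 2^-1.
  by rewrite /c0 normc_real ger0_norm// invr_ge0.
have n1 : normc c1 = 2^-1.
  apply: complexI; rewrite -norm_normc normrM !norm_normc n0.
  by rewrite /Normc.normc/= expr0n add0r expr1n sqrtr1 mul1r.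
have bp c : bounded_op (B + scal_op c).
  by have := bounded_op_lin 1 bB (bounded_scal_op c); rewrite scale1r.
have bm c : bounded_op (B - scal_op c).
  by have := bp (- c); rewrite scal_opN.
have ap c : is_adjoint ip (B + scal_op c) (B' + scal_op (c^*)%C).
  by have := adj_lin 1 BB' (adj_scal_op ip c); rewrite conjc1 !scale1r.
have am c : is_adjoint ip (B - scal_op c) (B' - scal_op (c^*)%C).
  by have := ap (- c); rewrite rmorphN !scal_opN.
have lp c := posL1_conj hn infH (bp c) (ap c) lT.
have lm c := posL1_conj hn infH (bm c) (am c) lT.
have lTl := bounded_lin lT.1.1; have lA := bounded_lin bA.
have lB := bounded_lin bB.
rewrite (Tr_eq (lp c0) (lm c0) (lp c1) (lm c1)).
  have e0 := tau_polarize hn infH BLxi lT gT bB BB' n0.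
  have e1 := tau_polarize hn infH BLxi lT gT bB BB' n1.
  apply: (etrans (f_equal2 (@Complex R) e0 e1)).
  apply: (f_equal2 (@Complex R)); apply: (congr1 psi); apply/funext => j.
    rewrite /re_ip /B fctE ipZl ipZr mulrA ReM /c0 conjc_real -rmorphM /= mul0r subr0.
    by field.
  rewrite /re_ip /B fctE ipZl ipZr /c1 /c0.
  by rewrite !(ReM, ImM, ReJ, ImJ) /=; field.
have pol c x : (((B + scal_op c) \o T \o (B' + scal_op (c^*)%C))
    - ((B - scal_op c) \o T \o (B' - scal_op (c^*)%C))) x =
    ((c^*)%C *: B (T x) + c *: T (B' x)) *+ 2.
  rewrite !fctE /= (linD _ _ lTl) (linB _ _ lTl) (linB _ _ lB) (linD _ _ lB).
  rewrite /scal_op !(linZ _ _ lTl) !(linZ _ _ lB) scalerDr scalerBr.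
  exact: sub_parallelogram.
apply/funext => x.
transitivity (((c0^*)%C *: B (T x) + c0 *: T (B' x)) *+ 2 +
  ('i : R[i]) *: (((c1^*)%C *: B (T x) + c1 *: T (B' x)) *+ 2)); last by rewrite -!pol.
have -> : B (T x) = c0 *: A (T x) by [].
move: (T (B' x)) => z; rewrite -[(A \o T) x]/(A (T x)); move: (A (T x)) => u.
rewrite -[(_ + c0 *: z) *+ 2]scaler_nat -[(_ + c1 *: z) *+ 2]scaler_nat.
rewrite !scalerDr !scalerA addrACA -!scalerDl.
have -> : 2 * (c0^*)%C * c0 + ('i : R[i]) * 2 * (c1^*)%C * c0 = 1.
  by apply: complex_ext; rewrite /c1 /c0 !(ReM, ImM, ReJ, ImJ, ReD, ImD) /=; field.
have -> : 2 * c0 + ('i : R[i]) * (2 * c1) = 0.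
  by apply: complex_ext; rewrite /c1 /c0 !(ReM, ImM, ReJ, ImJ, ReD, ImD) /=; field.
by rewrite scale1r scale0r addr0.
Qed.

End fixed_operator.
End trace_formula.

(** Basic neighbourhoods in the initial topology are preimages under [f]. *)
Lemma cvg_initial (S : choiceType) (T : topologicalType) (f : S -> T)
    (F : set_system S) (s : S) : Filter F ->
  f @ F --> f s -> F --> (s : initial_topology f).
Proof.
move=> FF h A [_ [[W oW <-] Ws WA]]; rewrite nbhs_filterE.
by apply: filterS WA _; apply: h; exact: open_nbhs_nbhs.
Qed.

(** * The Riesz theorem on a subspace *)

Section riesz.
Context {R : realType} {H : completeNormedModType R[i]}.
Variable ip : {dot H for Num.conj}.
Hypothesis hn : hilbert_norm ip.
Implicit Types (a : R[i]) (x y z : H).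
Local Notation rip := (re_ip ip).

Lemma nrm_complete (x : nat -> H) :
  (forall e : R, 0 < e -> exists N, forall n m, (N <= n)%N -> (N <= m)%N -> nrm (x n - x m) < e) ->
  exists k, forall e : R, 0 < e -> exists N, forall n, (N <= n)%N -> nrm (x n - k) < e.
Proof.
move=> cx.
have ReE (e : R[i]) : 0 < e -> e = (Re e)%:C /\ 0 < Re e.
  by rewrite ltcE => /andP[/eqP h1 h2]; split => //; apply: complex_ext => //=; rewrite -h1.
have : cvg (x @ \oo).
  apply: cauchy_cvg; apply/cauchy_ballP => e /ReE[-> /cx[N hN]].
  pose D := [set x n | n in [set n | (N <= n)%N]].
  have FD : (x @ \oo) D by exists N => // n Nn; exists n.
  exists (D, D) => // -[_ _] [/= [n Nn <-] [m Nm <-]].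
  by rewrite -ball_normE /= normE ltcR; exact: hN.
move=> cvx; exists (lim (x @ \oo)) => e e0.
have e0' : 0 < e%:C by rewrite ltcR.
move/cvgrPdist_lt : cvx => /(_ _ e0') [N _ hN].
by exists N => n Nn; have := hN n Nn; rewrite /= distrC normE ltcR.
Qed.

Lemma nrm_parallelogram x y :
  nrm (x + y) ^+ 2 + nrm (x - y) ^+ 2 = 2 * nrm x ^+ 2 + 2 * nrm y ^+ 2.
Proof. by rewrite -!(ripxx hn) !(ripDl, ripDr, ripNl, ripNr); ring. Qed.

(** At [t = - r / (q + 1)] the value is [- r^2 / (q + 1)^2]; adding 1 keeps the denominator away
    from 0. *)
Lemma quad_ge0_lin (q r : R) : (forall t : R, 0 <= t ^+ 2 * q + t * r) -> r = 0.
Proof.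
move=> h; have q0 : 0 <= q by have := h 1; have := h (-1); rewrite sqrrN expr1n; lra.
have := h (- r / (q + 1)); have q1 : 0 < q + 1 by lra.
rewrite (_ : _ + _ = - (r ^+ 2) / (q + 1) ^+ 2); last by field; lra.
rewrite pmulr_lge0 ?invr_gt0 ?exprn_gt0// oppr_ge0 => h1.
by apply/eqP; rewrite -sqrf_eq0 eq_le h1 sqr_ge0.
Qed.

(** [L] need not be closed, nor contain [k]. If [f = <., k>], the functional [J] below is
    [|x - k|^2 - |k|^2]; so [k] is found as the limit of a minimizing sequence of [J] in [L]. *)
Lemma riesz (L : set H) (f : H -> R[i]) (K : R) :
  L 0 -> (forall a x y, L x -> L y -> L (a *: x + y)) ->
  (forall a x y, L x -> L y -> f (a *: x + y) = a * f x + f y) ->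
  (forall x, L x -> normc (f x) <= K * nrm x) ->
  exists k, forall x, L x -> f x = ip x k.
Proof.
move=> L0 Ll fl fK.
have LD x y : L x -> L y -> L (x + y) by move=> Lx Ly; rewrite -[x]scale1r; exact: Ll.
have LZ a x : L x -> L (a *: x) by move=> Lx; rewrite -[_ *: _]addr0; exact: Ll.
have f0 : f 0 = 0.
  have := fl 1 0 0 L0 L0; rewrite scale1r addr0 mul1r => /eqP.
  by rewrite -subr_eq subrr eq_sym => /eqP.
have fZ a x : L x -> f (a *: x) = a * f x.
  by move=> Lx; have := fl a x 0 Lx L0; rewrite !addr0 f0 addr0.
have fD x y : L x -> L y -> f (x + y) = f x + f y.
  by move=> Lx Ly; have := fl 1 x y Lx Ly; rewrite scale1r mul1r.
pose J x := nrm x ^+ 2 - 2 * Re (f x).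
have Jge x : L x -> - K ^+ 2 <= J x.
  move=> Lx; have := fK x Lx; have := Re_le_normc (f x).
  rewrite ler_norml => /andP[_ h1] h2; rewrite /J.
  have := sqr_ge0 (nrm x - K); rewrite sqrrB => h3.
  by lra.
pose E := [set J x | x in L].
have infE : has_inf E.
  by split; [exists (J 0), 0|exists (- K ^+ 2) => _ [x Lx <-]; exact: Jge].
have Ji x : L x -> inf E <= J x by move=> Lx; apply: ge_inf; [exact: infE.2|exists x].
have /choice [x hx] : forall n : nat, exists x, L x /\ J x < inf E + n.+1%:R^-1.
  move=> n; have n0 : 0 < n.+1%:R^-1 :> R by rewrite invr_gt0.
  by have [_ [x Lx <-] h] := inf_adherent n0 infE; exists x.
have inv_small (e : R) : 0 < e -> exists N : nat, forall n, (N <= n)%N -> n.+1%:R^-1 < e.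
  move=> e0; have [N _ h] := near_infty_natSinv_lt (PosNum e0).
  by exists N => n Nn; exact: h.
have xx n m : nrm (x n - x m) ^+ 2 <= 2 * (n.+1%:R^-1 + m.+1%:R^-1).
  have [[Ln hln] [Lm hlm]] := (hx n, hx m).
  (* The midpoint of [x n] and [x m] lies in [L], so the parallelogram law turns near minimality
     into the Cauchy property. *)
  have := Ji _ (LZ (2^-1)%:C _ (LD _ _ Ln Lm)); have := nrm_parallelogram (x n) (x m).
  rewrite /J fZ; last exact: LD.
  rewrite fD// -[nrm (_ *: _) ^+ 2](ripxx hn) ripZl ripZr (ripxx hn).
  rewrite ReM ReD /= mul0r subr0 => h1 h2.
  rewrite /J in hln hlm; move: h1 h2 hln hlm.
  move: (nrm _ ^+ 2) (nrm _ ^+ 2) (nrm _ ^+ 2) (nrm _ ^+ 2) (Re _) (Re _) (inf E).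
  by move: (n.+1%:R^-1) (m.+1%:R^-1) => p q *; lra.
have [|k hk] := @nrm_complete x.
  move=> e e0; have e4 : 0 < e ^+ 2 / 4 by rewrite divr_gt0// exprn_gt0.
  have [N hN] := inv_small _ e4; exists N => n m /hN h1 /hN h2.
  rewrite -(@ltr_pXn2r _ 2%N) ?nnegrE ?nrm_ge0 ?(ltW e0)//.
  apply: le_lt_trans (xx n m) _; move: h1 h2.
  by move: (n.+1%:R^-1) (m.+1%:R^-1) => p q; lra.
have ReE y : L y -> Re (f y) = rip y k.
  move=> Ly; suff : 2 * (rip y k - Re (f y)) = 0 by lra.
  (* The first variation of [J] at [k] in the direction [y], tested at nearby [x n] because [k] may
     be outside [L]. *)
  apply: (@quad_ge0_lin (nrm y ^+ 2)) => t.
  apply/ler_addgt0Pr => e e0.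
  (* Makes [2 |t| |<y, x_n - k>| <= e / 2] once [|x_n - k| < e / (2 C)]; the 1 avoids a zero
     denominator. *)
  pose C := 2 * `|t| * nrm y + 1.
  have C0 : 0 < C by rewrite ltr_wpDl// !mulr_ge0 ?nrm_ge0.
  have eC : 0 < e / (2 * C) by rewrite divr_gt0// mulr_gt0.
  have e2 : 0 < e / 2 by rewrite divr_gt0.
  have [N1 h1] := hk _ eC; have [N2 h2] := inv_small _ e2.
  pose n := maxn N1 N2; have [Ln hln] := hx n.
  have {}h1 := h1 n (leq_maxl _ _); have {}h2 := h2 n (leq_maxr _ _).
  have := Ji _ (Ll t%:C y (x n) Ly Ln); rewrite /J fl// -[nrm (_ + _) ^+ 2](ripxx hn).
  rewrite !(ripDl, ripDr, ripZl, ripZr) !(ripxx hn) ReD ReM /= mul0r subr0 [rip (x n) y]ripC.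
  rewrite /J in hln => h3.
  have h4 : 2 * t * rip y (x n) <= 2 * t * rip y k + e / 2.
    have -> : rip y (x n) = rip y k + rip y (x n - k) by rewrite ripBr; ring.
    rewrite mulrDr lerD2l; apply: le_trans (ler_norm _) _.
    rewrite normrM normrM ger0_norm//.
    apply: (@le_trans _ _ (2 * `|t| * (nrm y * (e / (2 * C))))).
      rewrite ler_wpM2l ?mulr_ge0//; apply: le_trans (rip_cs hn _ _) _.
      by rewrite ler_wpM2l ?nrm_ge0 ?ltW.
    rewrite mulrA; apply: (@le_trans _ _ (C * (e / (2 * C)))).
      by rewrite ler_wpM2r ?(ltW eC)// lerDl.
    by rewrite le_eqVlt; apply/orP; left; apply/eqP; field; rewrite gt_eqF.
  by move: h2 hln h3 h4; move: (n.+1%:R^-1) (inf E) => p q; lra.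
exists k => y Ly; apply: complex_ext; first exact: ReE.
have := ReE _ (LZ 'i _ Ly); rewrite fZ// /re_ip ipZl !ReM /=.
by lra.
Qed.

End riesz.

(** * Positive contractions in a weakly closed algebra *)

Section tends.
Context {R : realType} {I : Type} (U : set_system I).
Implicit Types (f g : I -> R[i]) (a b l : R[i]).

Definition tends f l := forall e : R, 0 < e -> U [set A | normc (f A - l) < e].

Context {UU : ProperFilter U}.

Lemma tends_unique f l l' : tends f l -> tends f l' -> l = l'.
Proof.
move=> h h'; apply/eqP; rewrite -subr_eq0; apply/eqP/normc_eq0/eqP.
rewrite eq_le normc_ge0 andbT; apply/ler_addgt0Pr => e e0; rewrite add0r.
have e2 : 0 < e / 2 by rewrite divr_gt0.
have [A [/= h1 h2]] := filter_ex (filterI (h _ e2) (h' _ e2)).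
have -> : l - l' = (f A - l') - (f A - l) by ring.
apply: le_trans (normcD _ _) _; rewrite normcN; lra.
Qed.

Lemma tends_near f g l : U [set A | f A = g A] -> tends f l -> tends g l.
Proof.
move=> fg h e e0; apply: filterS (filterI fg (h e e0)) => A /= [-> //].
Qed.

Lemma tends_cst l : tends (fun=> l) l.
Proof.
by move=> e e0; apply: filterS filterT => A _ /=; rewrite subrr Normc.normc0.
Qed.

Lemma tendsD f g l l' : tends f l -> tends g l' -> tends (fun A => f A + g A) (l + l').
Proof.
move=> h h' e e0; have e2 : 0 < e / 2 by rewrite divr_gt0.
apply: filterS (filterI (h _ e2) (h' _ e2)) => A /= [h1 h2].
by rewrite opprD addrACA; apply: le_lt_trans (normcD _ _) _; lra.
Qed.

Lemma tendsZ a f l : tends f l -> tends (fun A => a * f A) (a * l).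
Proof.
move=> h e e0; have c0 : 0 < normc a + 1 by rewrite ltr_wpDl ?normc_ge0.
have e2 : 0 < e / (normc a + 1) by rewrite divr_gt0.
apply: filterS (h _ e2) => A /= h1; rewrite -mulrBr normcM.
rewrite ltr_pdivlMr// in h1; apply: le_lt_trans h1.
by rewrite mulrC ler_wpM2l ?normc_ge0// lerDl.
Qed.

Lemma tendsJ f l : tends f l -> tends (fun A => ((f A)^*)%C) (l^*)%C.
Proof.
move=> h e e0; apply: filterS (h e e0) => A /=.
by rewrite -rmorphB normcJ.
Qed.

Lemma tends_bound f l (K : R) : U [set A | normc (f A) <= K] -> tends f l -> normc l <= K.
Proof.
move=> fK h; apply/ler_addgt0Pr => e e0.
have [A [/= h1 h2]] := filter_ex (filterI fK (h _ e0)).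
rewrite (_ : l = f A - (f A - l)); last by ring.
by apply: le_trans (normcD _ _) _; rewrite normcN lerD// ltW.
Qed.

Lemma tends_Re_ge f l (K : R) : U [set A | K <= Re (f A)] -> tends f l -> K <= Re l.
Proof.
move=> fK h; apply/ler_addgt0Pr => e e0.
have [A [/= h1 h2]] := filter_ex (filterI fK (h _ e0)).
have := Re_le_normc (f A - l); rewrite ReD ReN ler_norml => /andP[_ h3]; lra.
Qed.

Lemma tends_Re_le f l (K : R) : U [set A | Re (f A) <= K] -> tends f l -> Re l <= K.
Proof.
move=> fK h; apply/ler_addgt0Pr => e e0.
have [A [/= h1 h2]] := filter_ex (filterI fK (h _ e0)).
have := Re_le_normc (f A - l); rewrite ReD ReN ler_norml => /andP[h3 _]; lra.
Qed.

Lemma tends_real f l : U [set A | Im (f A) = 0] -> tends f l -> Im l = 0.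
Proof.
move=> f0 h; apply/eqP; rewrite -normr_le0; apply/ler_addgt0Pr => e e0; rewrite add0r.
have [A [/= h1 h2]] := filter_ex (filterI f0 (h _ e0)).
have := Im_le_normc (f A - l); rewrite ImD ImN h1 add0r normrN; lra.
Qed.

End tends.

(** Compactness of [[-K, K]] gives a cluster point; for an ultrafilter it is a limit, as each ball
    or its complement has its preimage in [U]. *)
Lemma ultra_real_lim {R : realType} {I : Type} (U : set_system I) (g : I -> R) (K : R) :
  UltraFilter U -> U [set A | `|g A| <= K] ->
  exists l, forall e : R, 0 < e -> U [set A | `|g A - l| < e].
Proof.
move=> UU gK.
have gK' : (g @ U) `[- K, K]%classic.
  have : U (g @^-1` `[- K, K]); last exact.
  by apply: filterS gK => A /=; rewrite in_itv /= ler_norml.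
have [l [_ cl]] := @segment_compact _ (- K) K (g @ U) _ gK'.
exists l => e e0.
have [//|h] := in_ultra_setVsetC [set A | `|g A - l| < e] UU.
have nb : nbhs l (ball l e) by exact: nbhsx_ballx.
have fh : (g @ U) (~` ball l e).
  have : U (g @^-1` (~` ball l e)); last exact.
  by apply: filterS h => A /= hA; rewrite -ball_normE /= distrC.
by have [y [h1 h2]] := cl _ _ fh nb.
Qed.

Lemma ultra_tends {R : realType} {I : Type} (U : set_system I) (f : I -> R[i]) (K : R) :
  UltraFilter U -> U [set A | normc (f A) <= K] -> exists l, tends U f l.
Proof.
move=> UU fK.
have [|lr hr] := @ultra_real_lim _ _ U (fun A => Re (f A)) K UU.
  by apply: filterS fK => A /= h; exact: le_trans (Re_le_normc _) h.
have [|li hi] := @ultra_real_lim _ _ U (fun A => Im (f A)) K UU.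
  by apply: filterS fK => A /= h; exact: le_trans (Im_le_normc _) h.
exists (lr +i* li) => e e0; have e2 : 0 < e / 2 by rewrite divr_gt0.
apply: filterS (filterI (hr _ e2) (hi _ e2)) => A /= [h1 h2].
apply: le_lt_trans (normc_le_ReIm _) _; rewrite ReD ImD ReN ImN /=; lra.
Qed.

Section effects.
Context {R : realType} {H : completeNormedModType R[i]}.
Variable ip : {dot H for Num.conj}.
Hypothesis hn : hilbert_norm ip.
Variable M : set (H -> H).
Hypothesis sM : star_subalgebra ip M.
Hypothesis wM : weakly_closed ip M.
Implicit Types (a : R[i]) (x y z : H) (A B P : H -> H).
Local Notation rip := (re_ip ip).

(** The operators [0 <= A <= 1] of [M]. The upper bound is put on the quadratic form, as the
    identity need not belong to [M]. *)
Definition effects : set (H -> H) :=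
  [set A | [/\ M A, positive_op ip A & forall x, rip (A x) x <= nrm x ^+ 2]].

(** This is [A^2 <= A], by Cauchy-Schwarz for [<A x, y>] at [x] and [A x]. *)
Lemma effect_sqr_le A x : effects A -> nrm (A x) ^+ 2 <= rip (A x) x.
Proof.
move=> [_ pA A1]; have [->|Ax0] := eqVneq (nrm (A x) ^+ 2) 0; first exact: pos_rip_ge0.
have Axgt : 0 < nrm (A x) ^+ 2 by rewrite lt_def Ax0 sqr_ge0.
rewrite -(ler_pM2r Axgt) -expr2 -{1}(ripxx hn).
apply: le_trans (pos_cauchy _ _ pA) _.
by rewrite ler_wpM2l ?pos_rip_ge0.
Qed.

Lemma effect_nrm A x : effects A -> nrm (A x) <= nrm x.
Proof.
move=> eA; rewrite -ler_sqr ?nnegrE ?nrm_ge0//.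
by apply: le_trans (effect_sqr_le x eA) _; case: eA.
Qed.

Lemma effects_closure B : bounded_op B ->
  closure (effects : set (initial_topology (wot_map ip))) B -> M B.
Proof.
move=> bB cB; apply: wM; split => //.
by move=> V /cB [A [[MA _ _] VA]]; exists A.
Qed.

(** Weak compactness of the effects: the limits of [<y, A x>] along [U] are linear and bounded in
    [y], so Riesz on all of [H] yields [B x], and [B] is in [M] because [M] is weakly closed. *)
Lemma effect_limit (U : set_system (H -> H)) : UltraFilter U -> U effects ->
  exists2 B, effects B & forall x y, tends U (fun A => ip (A x) y) (ip (B x) y).
Proof.
move=> UU Ue.
have bd x y : U [set A | normc (ip y (A x)) <= nrm x * nrm y].
  apply: filterS Ue => A eA /=; apply: le_trans (normc_ip hn _ _) _.
  by rewrite mulrC ler_wpM2r ?nrm_ge0// effect_nrm.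
have /choice [l hl] : forall xy : H * H, exists l, tends U (fun A => ip xy.2 (A xy.1)) l.
  by move=> [x y]; apply: ultra_tends (bd x y).
have /choice [B hB] : forall x, exists k, forall y, setT y -> l (x, y) = ip y k.
  move=> x; apply: (@riesz _ _ ip hn setT (fun y => l (x, y)) (nrm x)) => //.
    move=> a y z _ _.
    apply: (tends_unique (hl (x, a *: y + z))) => /=.
    apply: (tends_near (f := fun A => a * ip y (A x) + ip z (A x))).
      by apply: filterS filterT => A _ /=; rewrite ipDl ipZl.
    apply: tendsD; last exact: (hl (x, z)).
    by apply: tendsZ; exact: (hl (x, y)).
  by move=> y _; apply: tends_bound (hl (x, y)); exact: bd.
have lim' x y : tends U (fun A => ip y (A x)) (ip y (B x)).
  by rewrite -hB//; exact: (hl (x, y)).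
have lim x y : tends U (fun A => ip (A x) y) (ip (B x) y).
  rewrite ipC; apply: (tends_near (f := fun A => ((ip y (A x))^*)%C)).
    by apply: filterS filterT => A _ /=; rewrite -ipC.
  exact: tendsJ.
have lB : linear B.
  move=> a x y; apply: (ip_sep hn) => z; rewrite ipDl ipZl.
  apply: (tends_unique (lim (a *: x + y) z)).
  apply: (tends_near (f := fun A => a * ip (A x) z + ip (A y) z)).
    apply: filterS Ue => A [_ [[lA _] _] _] /=.
    by rewrite lA ipDl ipZl.
  by apply: tendsD => //; exact: tendsZ.
have Bn x : nrm (B x) <= nrm x.
  have : normc (ip (B x) (B x)) <= nrm x * nrm (B x).
    apply: tends_bound (lim x (B x)); apply: filterS (bd x (B x)) => A /=.
    by rewrite [ip (A x) _]ipC normcJ.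
  rewrite (ip_self hn) normc_real ger0_norm ?sqr_ge0// expr2.
  have [->|B0] := eqVneq (nrm (B x)) 0; first by rewrite nrm_ge0.
  by rewrite ler_pM2r// lt_def B0 nrm_ge0.
have bB : bounded_op B.
  by apply/bounded_opP; split => //; exists 1 => // x; rewrite mul1r.
have pB : positive_op ip B.
  split => // x; rewrite lecE /=; apply/andP; split.
    apply/eqP; apply: tends_real (lim x x); apply: filterS Ue => A [_ pA _] /=.
    by rewrite (pos_ripE _ pA).
  apply: tends_Re_ge (lim x x); apply: filterS Ue => A [_ pA _] /=.
  exact: pos_rip_ge0.
exists B => //; split => //; last first.
  move=> x; apply: tends_Re_le (lim x x); apply: filterS Ue => A [_ _ A1] /=.
  exact: A1.
apply: effects_closure => // V nV.
suff UV : U V by have [A [h1 h2]] := filter_ex (filterI Ue UV); exists A.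
(* Weak operator convergence is tested through [wot_map], and there coordinate by coordinate. *)
move: V nV; apply: (@cvg_initial _ _ (wot_map ip) U B).
apply/cvg_sup => -[x y]; apply: cvg_initial => /=.
apply/cvgrPdist_lt => e e0.
have [eE e0'] : e = (Re e)%:C /\ 0 < Re e.
  move: e0; rewrite ltcE => /andP[/eqP h1 h2]; split => //.
  by apply: complex_ext => //=; rewrite -h1.
suff : U [set A | `|ip (B x) y - ip (A x) y : R[i]| < e] by [].
apply: filterS (lim x y _ e0') => A /= h.
by rewrite norm_normc eE ltcR normcB.
Qed.

End effects.

(** * From projections of [M] to all of [M] by maximizing a difference of quadratic forms *)

Section maximal_effect.
Context {R : realType} {H : completeNormedModType R[i]}.
Variable ip : {dot H for Num.conj}.
Hypothesis hn : hilbert_norm ip.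
Variable M : set (H -> H).
Hypothesis sM : star_subalgebra ip M.
Hypothesis wM : weakly_closed ip M.
Implicit Types (a : R[i]) (x y z : H) (A B P : H -> H).
Local Notation rip := (re_ip ip).
Local Notation effects := (effects ip M).

Let M_bounded A : M A -> bounded_op A. Proof. by case: sM => h _ _ _ _; exact: h. Qed.
Let M_lin a A B : M A -> M B -> M (a *: A + B).
Proof. by case: sM => _ _ h _ _; exact: h. Qed.
Let M_comp A B : M A -> M B -> M (A \o B).
Proof. by case: sM => _ _ _ h _; exact: h. Qed.
Let M_0 : M 0. Proof. by case: sM. Qed.

Lemma effect_sqr A : effects A -> effects (A \o A).
Proof.
move=> eA; have [MA pA A1] := eA.
have AAx x : rip ((A \o A) x) x = nrm (A x) ^+ 2.
  by rewrite /= (adj_rip _ _ (pos_selfadj pA)) (ripxx hn).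
split; first exact: M_comp.
  split; first by apply: M_bounded; exact: M_comp.
  by move=> x /=; rewrite (pos_selfadj pA) (ip_self hn) ler0c sqr_ge0.
move=> x; rewrite AAx; apply: le_trans (A1 x); exact: effect_sqr_le eA.
Qed.

Lemma rip_double_sub A x : positive_op ip A ->
  rip (((2 : R[i]) *: A - (A \o A)) x) x = 2 * rip (A x) x - nrm (A x) ^+ 2.
Proof.
move=> pA; rewrite ripBl /= (adj_rip (A x) x (pos_selfadj pA)) (ripxx hn).
have two : (2 : R[i]) = (2 : R)%:C by rewrite rmorphMn rmorph1.
by rewrite two ripZl.
Qed.

(** This is [1 - (1 - A)^2] written without the identity: the upper bound is [0 <= |x - A x|^2], and
    positivity follows from [A^2 <= A]. *)
Lemma effect_double_sub A : effects A -> effects ((2 : R[i]) *: A - (A \o A)).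
Proof.
move=> eA; have [MA pA A1] := eA.
have MB : M ((2 : R[i]) *: A - (A \o A)).
  have := M_lin (-1) (M_comp MA MA) (M_lin 2 MA M_0).
  by rewrite addr0 scaleN1r addrC.
have [_ pAA _] := effect_sqr eA.
split => //.
  split; first exact: M_bounded.
  move=> x; rewrite lecE /=; apply/andP; split; last first.
    rewrite -/(rip _ _) rip_double_sub//.
    by have := effect_sqr_le hn x eA; have := pos_rip_ge0 x pA; lra.
  rewrite ipBl [ip (((2 : R[i]) *: A) x) x]ipZl.
  rewrite (pos_ripE x pA) [ip ((A \o A) x) x](pos_ripE x pAA).
  by rewrite ImD ImN ImM /=; apply/eqP; ring.
move=> x; rewrite rip_double_sub//.
have := sqr_ge0 (nrm (x - A x)); rewrite -[nrm (x - A x) ^+ 2](ripxx hn).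
rewrite ripBl !ripBr [rip x (A x)]ripC.
by rewrite !(ripxx hn); lra.
Qed.

Lemma effect0 : effects 0.
Proof.
split => //; last by move=> x; rewrite [X in rip X _](_ : _ = 0)// rip0l sqr_ge0.
by split; [exact: bounded_op0|move=> x; rewrite [X in ip X _](_ : _ = 0)// ip0l].
Qed.

Section two_vectors.
Variables e h : H.
(** The goal for effects is [F A <= 0]; for projections of [M] it is the hypothesis of
    domination. *)
Let F A := rip (A e) e - rip (A h) h.

(** An ultrafilter containing all sets of near maximizers has a weak limit among the effects, and
    [F] is weakly continuous. *)
Lemma effect_max : exists2 B, effects B & forall A, effects A -> F A <= F B.
Proof.
pose E := [set F A | A in effects].
have supE : has_sup E.
  split; first by exists (F 0), 0 => //; exact: effect0.
  exists (nrm e ^+ 2) => _ [A [_ pA A1] <-]; rewrite /F.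
  by have := A1 e; have := pos_rip_ge0 h pA; lra.
pose D (d : R) := [set A | effects A /\ sup E - d < F A].
have D0 d : 0 < d -> D d !=set0.
  by move=> /sup_adherent /(_ supE) [_ [A eA <-] hA]; exists A.
pose G := filter_from [set d : R | 0 < d] D.
have PG : ProperFilter G.
  apply: filter_from_proper => //; apply: filter_from_filter.
    by exists 1 => /=.
  move=> d1 d2 /= d10 d20; exists (Num.min d1 d2); first by rewrite /= lt_min d10.
  move=> A [eA hA]; split; split => //; apply: le_lt_trans hA; rewrite lerD2l lerN2.
    by rewrite ge_min lexx.
  by rewrite ge_min lexx orbT.
have [U [UU GU]] := ultraFilterLemma PG.
have UD d : 0 < d -> U (D d) by move=> d0; apply: GU; exists d.
have Ue : U effects by apply: filterS (UD 1 _) => // A [].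
have [B eB lim] := effect_limit hn wM UU Ue.
exists B => // A eA; apply: (@le_trans _ _ (sup E)).
  by apply: ub_le_sup; [exact: supE.2|exists A].
apply/ler_addgt0Pr => d d0.
(* Three errors: the distance of [F A'] from the supremum and the two limits at [e] and [h]. *)
have d3 : 0 < d / 3 by rewrite divr_gt0.
have [A' [[_ h1] [/= h2 h3]]] :=
  filter_ex (filterI (UD _ d3) (filterI (lim e e _ d3) (lim h h _ d3))).
have := Re_le_normc (ip (A' e) e - ip (B e) e); have := Re_le_normc (ip (A' h) h - ip (B h) h).
move: h1; rewrite /F /re_ip !ReD !ReN !ler_norml => h1 /andP[h4 _] /andP[_ h5].
by lra.
Qed.

Lemma max_effect_sqr B : effects B -> (forall A, effects A -> F A <= F B) ->
  F (B \o B) = F B.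
Proof.
move=> eB maxB; have [_ pB _] := eB.
have h1 := maxB _ (effect_sqr eB); have h2 := maxB _ (effect_double_sub eB).
apply/eqP; rewrite eq_le h1 /=; move: h2; rewrite /F !rip_double_sub// /=.
have BB y : rip (B (B y)) y = nrm (B y) ^+ 2.
  by rewrite (adj_rip _ _ (pos_selfadj pB)) (ripxx hn).
by rewrite !BB; lra.
Qed.

Lemma iter_adj B m x y : positive_op ip B -> ip (iter m B x) y = ip x (iter m B y).
Proof.
move=> pB; elim: m x y => // m IH x y; rewrite iterS (pos_selfadj pB) IH.
by rewrite -iterSr.
Qed.

(** With [y = B^k x], the claim is [<B y, y> <= |y|^2] for [m = 2 k] and [|B y|^2 <= <B y, y>] for
    [m = 2 k + 1]. *)
Lemma effect_iter_noninc B m x : effects B ->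
  rip (iter m.+1 B x) x <= rip (iter m B x) x.
Proof.
move=> eB; have [_ pB B1] := eB.
have half k y : rip (iter (k + k) B y) y = nrm (iter k B y) ^+ 2.
  by rewrite iterD /re_ip iter_adj// -/(rip _ _) (ripxx hn).
have half1 k y : rip (iter (k + k).+1 B y) y = rip (B (iter k B y)) (iter k B y).
  by rewrite -addnS iterD /re_ip iter_adj.
rewrite -[m]odd_double_half -addnn; set k := m./2; case: (odd m); rewrite ?add0n ?add1n; last first.
  by rewrite half half1.
rewrite half1 -addnS -addSn half iterS; exact: effect_sqr_le.
Qed.

Lemma effect_iter_ge0 B m x : effects B -> 0 <= rip (iter m B x) x.
Proof.
move=> eB; have [_ pB B1] := eB.
rewrite -[m]odd_double_half -addnn; set k := m./2; case: (odd m); rewrite ?add0n ?add1n; last first.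
  by rewrite iterD /re_ip iter_adj// -/(rip _ _) (ripxx hn) sqr_ge0.
by rewrite -addnS iterD /re_ip iter_adj// iterS; exact: pos_rip_ge0.
Qed.

Lemma iter_diagE B m x : positive_op ip B -> ip (iter m B x) x = (rip (iter m B x) x)%:C.
Proof.
move=> pB; apply: complex_ext => //=.
have := congr1 (@complex.Im R) (ipC ip (iter m B x) x); rewrite -(iter_adj _ _ _ pB) ImJ.
lra.
Qed.

(** The diagonal of the powers is nonincreasing and nonnegative, hence convergent. This is what
    yields [B P = P] for a weak limit [P] of powers. *)
Lemma effect_diff_small B x (d : R) : effects B -> 0 < d ->
  exists N, forall n, (N <= n)%N -> normc (ip (iter n.+1 B x) x - ip (iter n B x) x) < d.
Proof.
move=> eB d0; have [_ pB _] := eB.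
pose u n := rip (iter n B x) x.
have ucv : cvgn u.
  apply: nonincreasing_is_cvgn; first by apply/nonincreasing_seqP => n; exact: effect_iter_noninc.
  by exists 0 => _ [n _ <-]; exact: effect_iter_ge0.
have d2 : 0 < d / 2 by rewrite divr_gt0.
move/cvgrPdist_lt : (ucv) => /(_ _ d2) [N _ hN].
exists N => n Nn; have := hN n Nn; have := hN n.+1 (leqW Nn).
have -> : ip (iter n.+1 B x) x - ip (iter n B x) x = (u n.+1 - u n)%:C.
  by rewrite !iter_diagE// rmorphB.
rewrite /mkset.
move: (lim _) (u n) (u n.+1) => l p q.
rewrite normc_real !ltr_norml => /andP[h1 h2] /andP[h3 h4].
by apply/andP; split; lra.
Qed.

(** Products are not weakly continuous, so [P^2 = P] takes two steps: [B P = P] because consecutive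
    powers merge, then [B^(2^n) P = P], where only one factor passes to the limit. The exponents
    [2^n] keep every power a maximizer, by repeated squaring. *)
Lemma max_effect_projection B : effects B -> (forall A, effects A -> F A <= F B) ->
  exists P, [/\ effects P, projection ip P & F P = F B].
Proof.
move=> eB maxB; have [_ pB _] := eB.
pose C n := iter (2 ^ n) B.
have CS n : C n.+1 = C n \o C n.
  by apply/funext => x; rewrite /C expnS mul2n -addnn iterD.
have eC n : effects (C n) /\ F (C n) = F B.
  elim: n => [|n [IH1 IH2]]; first by rewrite /C expn0 /=.
  rewrite CS; split; first exact: effect_sqr.
  by rewrite -IH2; apply: max_effect_sqr => // A eA; rewrite IH2; exact: maxB.
have [U [UU GU]] := @ultraFilterLemma _ (C @ \oo) _.
have PU : ProperFilter U := ultra_proper.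
have Utail N : U [set C n | n in [set n | (N <= n)%N]].
  by apply: GU; exists N => // n Nn; exists n.
have Ue : U effects by apply: filterS (Utail 0%N) => A [n _ <-]; exact: (eC n).1.
have [P eP limP] := effect_limit hn wM UU Ue.
have [MP pP _] := eP.
have BP : B \o P = P.
  apply: (op_diag_eq hn).
  - by apply: bounded_lin; apply: bounded_op_comp; [exact: pB.1|exact: pP.1].
  - exact: bounded_lin pP.1.
  move=> x /=; rewrite (pos_selfadj pB); apply/eqP; rewrite -subr_eq0; apply/eqP.
  apply: (tends_unique (U := U) (f := fun A => ip (A x) (B x) + (-1) * ip (A x) x)).
    by rewrite -[- ip (P x) x]mulN1r; apply: tendsD; [exact: limP|exact: tendsZ (limP _ _)].
  move=> d d0; have [N hN] := effect_diff_small x eB d0.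
  apply: filterS (Utail N) => _ [n Nn <-] /=.
  rewrite subr0 mulN1r /C -(pos_selfadj pB) -iterS; apply: hN.
  by apply: leq_trans Nn _; exact/ltnW/ltn_expl.
have BmP m x : iter m B (P x) = P x.
  elim: m => // m IH; rewrite iterS IH.
  by have := congr1 (fun A : H -> H => A x) BP.
have PP : P \o P = P.
  apply/funext => x; apply: (ip_sep hn) => y /=.
  apply: (tends_unique (limP (P x) y)).
  apply: (tends_near (f := fun=> ip (P x) y)); last exact: tends_cst.
  by apply: filterS (Utail 0%N) => _ [n _ <-] /=; rewrite /C BmP.
exists P; split => //; first by split => //; [exact: pP.1|exact: pos_selfadj].
have FE A : F A = complex.Re (ip (A e) e + (-1) * ip (A h) h).
  by rewrite /F mulN1r ReD ReN.
have l : tends U (fun A => ip (A e) e + (-1) * ip (A h) h) (ip (P e) e + (-1) * ip (P h) h).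
  by apply: tendsD; [exact: limP|exact: tendsZ (limP _ _)].
apply/eqP; rewrite FE eq_le; apply/andP; split.
  apply: (tends_Re_le (U := U) _ l); apply: filterS (Utail 0%N) => _ [n _ <-] /=.
  by rewrite -FE (eC n).2.
apply: (tends_Re_ge (U := U) _ l); apply: filterS (Utail 0%N) => _ [n _ <-] /=.
by rewrite -FE (eC n).2.
Qed.

Hypothesis dom : forall P, M P -> projection ip P -> nrm (P e) <= nrm (P h).

Lemma effect_dominated A : effects A -> rip (A e) e <= rip (A h) h.
Proof.
move=> eA; have [B eB maxB] := effect_max.
have [P [eP prP FP]] := max_effect_projection eB maxB.
rewrite -subr_le0; apply: le_trans (maxB A eA) _; rewrite -FP /F subr_le0.
have [_ aP PP] := prP; have [MP _ _] := eP.
have PE x : rip (P x) x = nrm (P x) ^+ 2.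
  by rewrite -[in LHS]PP /re_ip /= aP -/(rip _ _) (ripxx hn).
by rewrite !PE ler_sqr ?nnegrE ?nrm_ge0// dom.
Qed.

(** [A' A], scaled down to an effect [E], has [<E x, x>] proportional to [|A x|^2]. The scale uses
    [c + 1], which is nonzero even for [c = 0]. *)
Lemma nrm_dominated A : M A -> nrm (A e) <= nrm (A h).
Proof.
move=> MA; have [lA [c c0 cA]] := (bounded_opP A).1 (M_bounded MA).
have [A' MA' AA'] : exists2 B, M B & is_adjoint ip A B by case: sM => _ _ _ _; exact.
have c1 : 0 < c + 1 by lra.
pose t := (c + 1) ^- 2; have t0 : 0 < t by rewrite invr_gt0 exprn_gt0.
pose E := t%:C *: (A' \o A).
have ME : M E by have := M_lin t%:C (M_comp MA' MA) M_0; rewrite addr0.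
have EE x : ip (E x) x = (t * nrm (A x) ^+ 2)%:C.
  rewrite [E x]/(t%:C *: A' (A x)) ipZl (adj_sym AA') (ip_self hn).
  by rewrite -rmorphM.
have EE' x : rip (E x) x = t * nrm (A x) ^+ 2 by rewrite /re_ip EE.
have eE : effects E.
  split => //.
    split; first exact: M_bounded.
    by move=> x; rewrite EE ler0c mulr_ge0 ?sqr_ge0// ltW.
  move=> x; rewrite EE' /t mulrC ler_pdivrMr ?exprn_gt0// mulrC -exprMn.
  rewrite ler_sqr ?nnegrE ?mulr_ge0 ?nrm_ge0 ?(ltW c1)//; apply: le_trans (cA x) _.
  by rewrite ler_wpM2r ?nrm_ge0// lerDl.
have := effect_dominated eE; rewrite !EE' ler_pM2l//.
by rewrite ler_sqr ?nnegrE ?nrm_ge0.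
Qed.

End two_vectors.
End maximal_effect.

(** * Ultraweak continuity of vector functionals *)

Section normality.
Context {R : realType} {H : completeNormedModType R[i]}.
Variable ip : {dot H for Num.conj}.
Implicit Types (a : R[i]) (x y z : H) (A B T : H -> H).

Definition delta_seq x : nat -> H := fun n => if n == 0%N then x else 0.

Lemma series_delta (u : nat -> R[i]^o) : (forall n, u n.+1 = 0) ->
  forall n, (0 < n)%N -> series u n = u 0%N.
Proof.
by move=> u0 [//|n] _; rewrite /series /= big_nat_recl// big1 ?addr0.
Qed.

Lemma series_delta_cvg (u : nat -> R[i]^o) : (forall n, u n.+1 = 0) ->
  series u @ \oo --> u 0%N.
Proof.
move=> u0; apply: cvg_near_cst; exists 1%N => // n /= n1.
exact: series_delta.
Qed.

Lemma ell2_delta x : ell2 (delta_seq x).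
Proof.
apply/cvg_ex; eexists; apply: series_delta_cvg => n.
by rewrite /delta_seq /= normr0 expr0n.
Qed.

(** [<A h, k>] is the coordinate of [ultraweak_map] at the one-term sequences of [h] and [k]. *)
Lemma vector_functional_continuous h k :
  continuous ((fun A => ip (A h) k) : initial_topology (ultraweak_map ip) -> R[i]^o).
Proof.
pose X : ell2 (H := H) := SigSub (mem_set (@ell2_delta h)).
pose Y : ell2 (H := H) := SigSub (mem_set (@ell2_delta k)).
have -> : (fun A : H -> H => ip (A h) k : R[i]^o) =
    (fun F : {ptws (ell2 (H := H) * ell2 (H := H)) -> R[i]^o} => F (X, Y)) \o ultraweak_map ip.
  apply/funext => A; rewrite /= /ultraweak_map /=; apply/esym/cvg_lim => //.
  apply: (@series_delta_cvg (fun n => ip (A (delta_seq h n)) (delta_seq k n))) => n.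
  by rewrite /delta_seq /= ip0r.
move=> A; apply: continuous_comp; first exact: initial_continuous.
exact: (@proj_continuous _ (fun=> R[i]^o) (X, Y)).
Qed.

End normality.

(** * Normality of [A |-> Tr_w (A T)] on [M] *)

Unset Implicit Arguments.

Theorem theorem3p13 (R : realType) (H : completeNormedModType R[i])
    (ip : {dot H for Num.conj}) (M : set (H -> H)) (h : H) (T : H -> H) :
  hilbert_norm ip -> separable (H := H) ->
  star_subalgebra ip M -> weakly_closed ip M ->
  positive_op ip T -> L1infty ip T -> dominated ip M h T ->
  forall w : (nat -> R) -> R, (Lmap @` (BL `&` DL)) w ->
    predual ip M (fun A => Tr ip w (A \o T)).
Proof.
move=> hn _ sM wM pT L1T [_ cT [e [oe ev dom]]] _ [xi [BLxi _] <-].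
have lT : positive_L1infty ip T by [].
have infH : inf_dim ip by exists e => n i j _ _; exact: oe.1.
(* The eigenvalues are ordered inside the given basis, since domination is known only for the
   vectors [e m]. *)
have [m [s gT]] := exists_greedy_basis hn pT cT oe ev.
pose v := e \o m; rewrite -/v in gT.
have [Mb M0 Ml _ Ma] := sM.
have nv A j : M A -> nrm (A (v j)) <= nrm (A h).
  move=> MA; apply: (nrm_dominated hn sM wM _ MA) => P MP pP.
  by have := dom P MP pP (m j); rewrite !normE lecR.
have v1 j : nrm (v j) = 1 := greedy_unit hn gT j.
pose q A j := ip (A (v j)) (v j).
have qb A j : M A -> normc (q A j) <= nrm (A h).
  move=> MA; apply: le_trans (normc_ip hn _ _) _; rewrite v1 mulr1; exact: nv.
have Rb A j : M A -> `|Re (q A j)| <= nrm (A h).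
  by move=> MA; apply: le_trans (Re_le_normc _) (qb A j MA).
have Ib A j : M A -> `|Im (q A j)| <= nrm (A h).
  by move=> MA; apply: le_trans (Im_le_normc _) (qb A j MA).
have lR A : M A -> linfty (fun j => Re (q A j)) by move=> MA; exists (nrm (A h)) => j; exact: Rb.
have lI A : M A -> linfty (fun j => Im (q A j)) by move=> MA; exists (nrm (A h)) => j; exact: Ib.
pose Phi A := psi xi s (fun j => Re (q A j)) +i* psi xi s (fun j => Im (q A j)).
have TrE A : M A -> Tr ip (Lmap xi) (A \o T) = Phi A.
  move=> MA; have [A' _ AA'] := Ma A MA.
  exact: (Tr_formula hn infH BLxi lT gT (Mb A MA) AA').
have qlin a A B j : q (a *: A + B) j = a * q A j + q B j.
  by rewrite /q ipDl ipZl.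
(* A complex scalar mixes real and imaginary parts, so each part of [Phi (a *: A + B)] is a
   combination of three real sequences. *)
have psi3 (c d : R) f g k : linfty f -> linfty g -> linfty k ->
    psi xi s (fun j => c * f j + (d * g j + k j)) = c * psi xi s f + (d * psi xi s g + psi xi s k).
  move=> lf lg lk.
  have e1 := psi_lin hn infH BLxi lT gT d lg lk.
  by rewrite -e1; apply: (psi_lin hn infH BLxi lT gT c lf (linfty_lin d lg lk)).
have Philin a A B : M A -> M B -> Phi (a *: A + B) = a * Phi A + Phi B.
  move=> MA MB; apply: complex_ext; rewrite !(ReD, ImD, ReM, ImM) /=.
    have -> : (fun j => Re (q (a *: A + B) j)) =
        (fun j => Re a * Re (q A j) + (- Im a * Im (q A j) + Re (q B j))).
      by apply/funext => j; rewrite qlin ReD ReM; ring.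
    rewrite (psi3 _ _ _ _ _ (lR A MA) (lI A MA) (lR B MB)).
    by rewrite mulNr addrA.
  have -> : (fun j => Im (q (a *: A + B) j)) =
      (fun j => Re a * Im (q A j) + (Im a * Re (q A j) + Im (q B j))).
    by apply/funext => j; rewrite qlin ImD ImM; ring.
  rewrite (psi3 _ _ _ _ _ (lI A MA) (lR A MA) (lI B MB)).
  by rewrite addrA.
(* The factor 2 arises because the real and imaginary parts are bounded separately. *)
have Phib A : M A -> normc (Phi A) <= 2 * tau ip xi T * nrm (A h).
  move=> MA; apply: le_trans (normc_le_ReIm _) _.
  have h1 := psi_bound hn infH BLxi lT gT (fun j => Rb A j MA).
  have h2 := psi_bound hn infH BLxi lT gT (fun j => Ib A j MA).
  apply: le_trans (lerD h1 h2) _.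
  by rewrite -mulrDl mulrC -mulr2n -[nrm (A h) *+ 2]mulr_natl mulrA [_ * 2]mulrC.
(* [Phi A] depends on [A h] only: if [A h = A0 h], the bound at [A - A0] is 0. Outside [M h] the
   default value is 0. *)
have /choice [f hf] : forall x, exists c, forall A, M A -> A h = x -> Phi A = c.
  move=> x; have [[A0 [MA0 A0x]]|no] := pselect (exists A, M A /\ A h = x); last first.
    by exists 0 => A MA Ax; case: no; exists A.
  exists (Phi A0) => A MA Ax.
  have := Phib _ (Ml (-1) A0 A MA0 MA).
  rewrite Philin// (_ : ((-1 : R[i]) *: A0 + A) h = 0); last first.
    by rewrite !fctE A0x Ax scaleN1r addNr.
  rewrite nrm0 mulr0 => le0; have /normc_eq0 : normc ((-1) * Phi A0 + Phi A) = 0.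
    by apply/eqP; rewrite eq_le le0 normc_ge0.
  by rewrite mulN1r addrC => /eqP; rewrite subr_eq0 => /eqP.
have [|a _ _ [A MA <-] [B MB <-]|a _ _ [A MA <-] [B MB <-]|_ [A MA <-]|k hk] :=
    @riesz _ _ ip hn [set A h | A in M] f (2 * tau ip xi T).
- by exists 0.
- by exists (a *: A + B) => //; exact: Ml.
- rewrite -(hf _ A MA erefl) -(hf _ B MB erefl) -Philin//.
  by apply/esym/hf => //; exact: Ml.
- by rewrite -(hf _ A MA erefl); exact: Phib.
have TrV A : M A -> Tr ip (Lmap xi) (A \o T) = ip (A h) k.
  move=> MA; rewrite TrE// (hf _ A MA erefl); apply: hk.
  by exists A.
split.
  move=> c A B MA MB; rewrite !TrE//; first exact: Philin.
  exact: Ml.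
(* On [M] the trace agrees with a vector functional, which is ultraweakly continuous everywhere. *)
have := @continuous_subspaceT _ _ (M : set (initial_topology (ultraweak_map ip))) _
  (@vector_functional_continuous R H ip h k).
apply: subspace_eq_continuous => A; rewrite inE => MA /=.
exact/esym/TrV.
Qed.
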